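(* Let $p$ be a prime and let $G$ be a finite irreducible subgroup of $\mathrm{GL}(V)\cong\mathrm{GL}_{p^n}(\mathbb{C})$ satisfying $(\mathbf{S+})$ which is an extraspecial normalizer: $G\rhd R=\mathbf{Z}(R)E$ for some extraspecial $p$-group $E$ of order $p^{1+2n}$ acting irreducibly on $V$, with either $R=E$ or $\mathbf{Z}(R)\cong C_4$. Suppose that a $p'$-element $g\in G$ has simple spectrum on $V$ and that $p^n\ge11$. Then: (i) if $p>2$, then $\exp(R)=p$, $\bar{\mathsf{o}}(g)=p^n+1$, and the coset $g\mathbf{Z}(G)R$, as an element of $G/\mathbf{Z}(G)R\hookrightarrow\mathrm{Sp}_{2n}(p)$, generates a cyclic maximal torus $C_{p^n+1}$ of $\mathrm{Sp}_{2n}(p)$; (ii) if $p=2$, then there are integers $a_1>a_2>\cdots>a_t\ge1$ with $n=\sum_{i=1}^ta_i$, $\gcd(2^{a_i}+1,2^{a_j}+1)=1$ for $i\neq j$, $\bar{\mathsf{o}}(g)=\prod_{i=1}^t(2^{a_i}+1)$, and the coset $g\mathbf{Z}(G)R$, as an element of $G/\mathbf{Z}(G)R\hookrightarrow\mathrm{Sp}_{2n}(2)$, generates a cyclic maximal torus $C_{2^{a_1}+1}\times\cdots\times C_{2^{a_t}+1}$ of $\mathrm{Sp}_{2n}(2)$.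
   Context: $\bar{\mathsf{o}}(g)$ denotes the order of $g\mathbf{Z}(G)$ in $G/\mathbf{Z}(G)$; $g$ has simple spectrum if all its eigenvalues on $V$ have multiplicity one. $G/\mathbf{Z}(G)R$ embeds in the group of outer automorphisms of $R$ acting trivially on $\mathbf{Z}(R)$, which embeds in $\mathrm{Sp}(E/\mathbf{Z}(E))\cong\mathrm{Sp}_{2n}(p)$. $(G,V)$ satisfies $(\mathbf{S+})$ if $G$ is irreducible, primitive (no decomposition $V=\bigoplus_{i=1}^tV_i$, $t>1$, $V_i\neq0$, permuted by $G$), tensor indecomposable (no $V=A\otimes B$, $\dim A,\dim B\ge2$, with $G\subseteq\mathrm{GL}(A)\otimes\mathrm{GL}(B)$), not tensor induced (for no $m\ge2$ is $V=A_1\otimes\cdots\otimes A_m$ with equal $\dim A_i\ge2$ and $G\subseteq(\bigotimes\mathrm{GL}(A_i))\rtimes\mathsf{S}_m$), and $\det(G)$ is finite. *)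

(* Defs.v *)
From HB Require Import structures.
From mathcomp Require Import all_boot all_order all_algebra all_fingroup.
From mathcomp Require Import all_solvable all_field all_character.
From mathcomp Require Import mxtens complex reals.

Set Implicit Arguments.
Unset Strict Implicit.
Unset Printing Implicit Defensive.

Import GroupScope GRing.Theory.
Local Open Scope ring_scope.

Section TensorPower.

Variables (F : fieldType) (m k : nat).

(* The tensor product of m copies of F^k, as row vectors: its standard basis
   e_(f 0) (x) ... (x) e_(f (m-1)) is indexed by the f : {ffun 'I_m -> 'I_k},
   enumerated through enum_val. *)
Definition tens_dim := #|{ffun 'I_m -> 'I_k}|.

Definition tens_idx (i : 'I_tens_dim) : {ffun 'I_m -> 'I_k} := enum_val i.

Definition bigtens (X : 'I_m -> 'M[F]_k) : 'M[F]_tens_dim :=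
  \matrix_(i, j) \prod_(l < m) X l (tens_idx i l) (tens_idx j l).

Definition tens_perm (s : 'S_m) : 'M[F]_tens_dim :=
  \matrix_(i, j) (tens_idx j == [ffun l => tens_idx i (s l)])%:R.

End TensorPower.

Section SPlus.

Variables (F : fieldType) (gT : finGroupType) (G : {group gT}) (d : nat).
Variable rG : mx_representation F G d.

Definition imprimitive : Prop :=
  exists (t : nat) (V_ : 'I_t -> 'M[F]_d),
    [/\ (1 < t)%N,
        forall i, V_ i != 0,
        (\sum_i V_ i :=: 1%:M)%MS,
        mxdirect (\sum_i V_ i)
      & forall x, x \in G ->
          exists s : 'S_t, forall i, (V_ i *m rG x :=: V_ (s i))%MS].

Definition tensor_decomposable : Prop :=
  exists (a b : nat) (phi : 'M[F]_(d, a * b)),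
    [/\ (2 <= a)%N, (2 <= b)%N, row_free phi, row_full phi
      & forall x, x \in G ->
          exists (X : 'M[F]_a) (Y : 'M[F]_b),
            [/\ X \in unitmx, Y \in unitmx
              & rG x *m phi = phi *m (X *t Y)]].

Definition tensor_induced : Prop :=
  exists (m k : nat) (phi : 'M[F]_(d, tens_dim m k)),
    [/\ (2 <= m)%N, (2 <= k)%N, row_free phi, row_full phi
      & forall x, x \in G ->
          exists (X : 'I_m -> 'M[F]_k) (s : 'S_m),
            (forall l, X l \in unitmx) /\
            rG x *m phi = phi *m (bigtens X *m tens_perm F k s)].

Definition finite_det : Prop :=
  exists D : seq F, forall x, x \in G -> \det (rG x) \in D.

Definition Splus : Prop :=
  [/\ mx_irreducible rG, ~ imprimitive, ~ tensor_decomposable,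
      ~ tensor_induced & finite_det].

Definition simple_spectrum (g : gT) : Prop :=
  forall a, eigenvalue (rG g) a -> mup a (char_poly (rG g)) = 1%N.

End SPlus.

Definition symp_form (F : fieldType) (n : nat) : 'M[F]_(n + n) :=
  block_mx 0 1%:M (- 1%:M) 0.

Definition symplectic (F : fieldType) (n : nat) (X : 'M[F]_(n + n)) : Prop :=
  X *m symp_form F n *m X^T = symp_form F n.

Section Torus.

Variable L : fieldType.

Definition in_Gm (r : nat) (t : 'rV[L]_r) : Prop := forall i, t 0 i != 0.

Definition regular_Gm (r : nat) (f : 'rV[L]_r -> L) : Prop :=
  exists (I : finType) (c : I -> L) (e : I -> 'I_r -> int),
    forall t, in_Gm t -> f t = \sum_k c k * \prod_i (t 0 i) ^ (e k i).

Definition regular_GL (m : nat) (f : 'M[L]_m -> L) : Prop :=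
  exists (I : finType) (c : I -> L) (e : I -> 'I_m -> 'I_m -> nat) (N : nat),
    forall X, X \in unitmx ->
      f X = (\sum_k c k * \prod_i \prod_j (X i j) ^+ (e k i j)) / \det X ^+ N.

(* T is an algebraic subgroup of GL_m isomorphic to Gm^r: phi is a homomorphism
   of algebraic groups from Gm^r to GL_m with image T (which is therefore
   closed, for L algebraically closed), and psi restricts to its regular
   inverse on T. *)
Definition torus (m : nat) (T : 'M[L]_m -> Prop) : Prop :=
  exists (r : nat) (phi : 'rV[L]_r -> 'M[L]_m) (psi : 'M[L]_m -> 'rV[L]_r),
    [/\ (forall t, in_Gm t -> phi t \in unitmx) /\
        (forall s t, in_Gm s -> in_Gm t ->
           phi (map2_mx *%R s t) = phi s *m phi t),
        forall i j, regular_Gm (fun t => phi t i j),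
        forall i, regular_GL (fun X => psi X 0 i),
        forall t, in_Gm t -> psi (phi t) = t
      & forall X, T X <-> exists2 t, in_Gm t & X = phi t].

Definition symp_max_torus (n : nat) (T : 'M[L]_(n + n) -> Prop) : Prop :=
  [/\ torus T, forall X, T X -> symplectic X
    & forall T', torus T' -> (forall X, T' X -> symplectic X) ->
        (forall X, T X -> T' X) -> forall X, T' X -> T X].

End Torus.

Definition Fpbar (p : nat) : countClosedFieldType :=
  tag (countable_algebraic_closure 'F_p).

Definition Fp_inj (p : nat) : {rmorphism 'F_p -> Fpbar p} :=
  sval (tagged (countable_algebraic_closure 'F_p)).

(* The maximal tori of the finite group Sp_2n(p) are the groups of rational
   points T^F of the Frobenius-stable maximal tori T of the algebraic group
   Sp_2n over the algebraic closure of F_p. *)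
Definition finite_Sp_max_torus (p n : nat) (H : {set 'M['F_p]_(n + n)}) : Prop :=
  exists T : 'M[Fpbar p]_(n + n) -> Prop,
    [/\ symp_max_torus T,
        forall X, T X <-> T (map_mx (fun x => x ^+ p) X)
      & forall X : 'M['F_p]_(n + n), X \in H <-> T (map_mx (@Fp_inj p) X)].

Section Embedding.

Variables (gT : finGroupType) (p n : nat) (G R : {group gT}).

(* b induces an isomorphism from R / Z(R) to F_p^(2n) carrying the commutator
   form to the standard symplectic form. When R = Z(R)E as in the theorem,
   E / Z(E) = R / Z(R); the latter is used since G normalizes R but, when
   Z(R) = C_4, not necessarily E. *)
Definition symp_coord (b : gT -> 'rV['F_p]_(n + n)) : Prop :=
  [/\ {in R &, forall x y, b (x * y)%g = b x + b y},
      forall v, exists2 x, x \in R & b x = v,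
      {in R, forall x, b x = 0 <-> x \in 'Z(R)}
    & exists z : gT,
        [/\ z \in 'Z(R), #[z] = p
          & {in R &, forall x y,
               [~ x, y] =
               (z ^+ nat_of_ord ((b x *m symp_form 'F_p n *m (b y)^T) 0 0)%R)%g}]].

(* rW is the embedding of G / Z(G)R in Sp_2n(p) given by conjugation on
   R / Z(R), in the coordinates b. *)
Definition symp_embedding (b : gT -> 'rV['F_p]_(n + n))
    (rW : mx_representation 'F_p (G / ('Z(G) <*> R))%G (n + n)) : Prop :=
  [/\ {in G & R, forall h x,
         b (x ^ h)%g = b x *m rW (coset ('Z(G) <*> R) h)},
      mx_faithful rW
    & {in (G / ('Z(G) <*> R))%g, forall y, symplectic (rW y)}].

(* The embedding in Sp_2n(p) depends on the choice of b; the property is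
   asserted for all choices, together with the existence of one. *)
Definition generates_max_torus (g : gT) : Prop :=
  (exists b, symp_coord b) /\
  forall b, symp_coord b ->
    exists2 rW : mx_representation 'F_p (G / ('Z(G) <*> R))%G (n + n),
      symp_embedding b rW
    & finite_Sp_max_torus [set rW y | y in <[coset ('Z(G) <*> R) g]>%g].

End Embedding.

(* Main.v *)
(* Let A be the matrix of g acting on W = R / Z(R) = F_p^2n by conjugation.
   Averaging the image of a p'-element h of G over R gives a scalar matrix, whence
   chi(h) chi(h^-1) = #|C_W(h)| for the character chi of V; as g has simple
   spectrum, summing over the powers of g shows that <g> has exactly p^n orbits
   on W.  Over the algebraic closure A is diagonalizable, and its spectrum is
   closed under inversion and Frobenius.  If D_M eigenvalues have order M, this
   closure forces (M - 1)^2 <= p^D_M, and an inclusion-exclusion bound on the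
   number of orbits gives at least p^n of them, with equality only if each
   occurring order is M = p^a + 1 with D_M = 2a, the orders are pairwise coprime
   and the eigenvalues are distinct.  Then the centralizer of A in Sp_2n over the
   closure is a maximal torus, and its rational points are the powers of A. *)
Require Import Defs.
From mathcomp Require Import all_boot all_order all_algebra all_fingroup.
From mathcomp Require Import all_solvable all_field all_character.
From mathcomp Require Import mxtens complex reals.
From mathcomp Require Import zify ring.

Set Implicit Arguments.
Unset Strict Implicit.
Unset Printing Implicit Defensive.

Import GroupScope.

(** * Counting orbits *)

Section OrbitCount.
Import Order.TTheory GRing.Theory Num.Theory.
Local Open Scope ring_scope.

(** The number of orbits is a sum over sets S of eigenvalue orders, with terms prod_{M in S} (p^D_M
    - 1) / lcm(S). Replacing lcm(S) by the product of S can only lower it, and turns it into prod_M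
    (1 + (p^D_M - 1)/M). The square of each factor exceeds p^D_M by a positive multiple of p^D_M -
    (M - 1)^2, and the D_M add up to 2n. Equality can thus be read off term by term: the sets give
    coprimality, the orders give (M - 1)^2 = p^D_M. Being a p'-element matters twice: it makes A
    semisimple, and it lets a vector of W fixed by a power of g lift to elements of R that this
    power centralizes. That Z(G)R is the whole kernel of the action on W is proved: an element
    acting trivially on W has the same commutators with R as some element of R. For odd p every p^a
    + 1 is even, so coprimality leaves a single order. *)

Lemma biglcm_dvd_prod (I : finType) (A : pred I) (F : I -> nat) :
  (\big[lcmn/1%N]_(i | A i) F i %| \prod_(i | A i) F i)%N.
Proof.
by apply/dvdn_biglcmP => i Ai; rewrite (bigD1 i) //= dvdn_mulr.
Qed.

Lemma sum_ord_dvdn (l N : nat) : (0 < N)%N -> (l %| N)%N ->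
  (\sum_(k < N) (l %| k) = N %/ l)%N.
Proof.
move=> N0 /dvdnP[q defN]; have l0 : (0 < l)%N by case: l defN N0 => //; lia.
rewrite defN mulnK //.
transitivity (\sum_(0 <= k < q * l) (l %| k))%N; first by rewrite big_mkord.
elim: q {defN} => [|q IHq]; first by rewrite big_geq.
rewrite mulSn addnC (@big_cat_nat _ _ _ (q * l)) ?leq_addr //= IHq -addn1; congr addn.
rewrite -{1}[(q * l)%N]add0n big_addn addKn.
rewrite big_ltn // add0n dvdn_mull // big_nat_cond big1 ?addn0 // => i.
rewrite andbT => /andP[i0 il]; apply/eqP; rewrite eqb0 dvdn_addl ?dvdn_mull //.
by rewrite gtnNdvd.
Qed.

Variables (t N p n : nat) (M D : 'I_t -> nat).
Hypotheses (N_gt0 : (0 < N)%N) (dvdMN : forall i, (M i %| N)%N) (p_gt1 : (1 < p)%N).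
Hypotheses (D_gt0 : forall i, (0 < D i)%N) (sumD : (\sum_i D i = n + n)%N).
Hypothesis leMD : forall i, ((M i).-1 ^ 2 <= p ^ D i)%N.
(** In the application [D i] is the number of eigenvalues of order [M i], so the k-th power fixes a
    space whose dimension is the sum of the [D i] with [M i] dividing [k]. This is Burnside's
    formula with [p ^ n] orbits. *)
Hypothesis count : (\sum_(k < N) \prod_i (if M i %| k then p ^ D i else 1) = N * p ^ n)%N.

Let c i : rat := (p ^ D i)%:R - 1.

Let M_gt0 i : (0 < M i)%N.
Proof. exact: dvdn_gt0 (dvdMN i). Qed.

Let c_gt0 i : 0 < c i.
Proof.
by rewrite subr_gt0 ltr1n -(exp1n (D i)) ltn_exp2r ?p_gt1 ?D_gt0.
Qed.

Let lcmS (S : {set 'I_t}) := \big[lcmn/1%N]_(i in S) M i.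
Let prodS (S : {set 'I_t}) := (\prod_(i in S) M i)%N.

Let lcmS_dvdN S : (lcmS S %| N)%N.
Proof. by apply/dvdn_biglcmP => i _. Qed.

Let lcmS_gt0 S : (0 < lcmS S)%N.
Proof. exact: dvdn_gt0 (lcmS_dvdN S). Qed.

Let prodS_gt0 S : (0 < prodS S)%N.
Proof. by rewrite prodn_gt0. Qed.

Let expand (x : 'I_t -> rat) :
  \prod_i (1 + x i) = \sum_(S : {set 'I_t}) \prod_(i in S) x i.
Proof.
under eq_bigr do rewrite addrC.
rewrite bigA_distr; apply: eq_bigr => S _; rewrite [RHS]big_mkcond /=.
by apply: eq_bigr.
Qed.

(** Each factor in [count] is [1 + c i] or 1 according to divisibility. Distributing over subsets
    leaves the indicators of [lcmS S] dividing [k], whose mean over [N] values is the inverse of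
    [lcmS S]. *)
Let sum_lcm :
  \sum_(S : {set 'I_t}) \prod_(i in S) c i / (lcmS S)%:R = (p ^ n)%:R.
Proof.
have N0 : (N%:R : rat) != 0 by rewrite pnatr_eq0 -lt0n.
apply: (mulfI N0); rewrite -natrM -count natr_sum.
transitivity (\sum_(k < N) \sum_(S : {set 'I_t}) \prod_(i in S) c i * (lcmS S %| k)%:R).
  rewrite exchange_big mulr_sumr; apply: eq_bigr => S _.
  rewrite -mulr_sumr -natr_sum sum_ord_dvdn // mulrCA; congr (_ * _).
  by rewrite natf_div.
apply: eq_bigr => k _; rewrite natr_prod.
transitivity (\prod_i (1 + c i * (M i %| k)%:R)).
  rewrite expand; apply: eq_bigr => S _; rewrite big_split /=; congr (_ * _).
  have [/dvdn_biglcmP dS | ndS] := boolP (lcmS S %| k)%N.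
    by rewrite big1 // => i Si; rewrite dS.
  have [/forall_inP dS | ] := boolP [forall i in S, M i %| k]%N.
    by case/negP: ndS; apply/dvdn_biglcmP => i Si; apply: dS.
  by rewrite negb_forall_in => /exists_inP[i Si /negPf ni]; rewrite (bigD1 i) //= ni mul0r.
apply: eq_bigr => i _; case: ifP => _; rewrite ?mulr1 ?mulr0 ?addr0 //.
by rewrite /c addrC subrK.
Qed.

(** This identity is why [(M - 1) ^ 2] is the quantity compared with [p ^ D]: the sign of the
    excess, and its vanishing, depend on that difference alone. *)
Let factorE i : (1 + c i / (M i)%:R) ^+ 2 - (p ^ D i)%:R =
  ((p ^ D i)%:R - ((M i).-1 ^ 2)%:R) * c i / (M i)%:R ^+ 2.
Proof.
have m0 : ((M i)%:R : rat) != 0 by rewrite pnatr_eq0 -lt0n.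
have -> : ((M i).-1 ^ 2)%:R = ((M i)%:R - 1) ^+ 2 :> rat.
  by rewrite natrX -{2}(prednK (M_gt0 i)) -natr1 addrK.
by rewrite /c; field.
Qed.

Let factor_ge i : (p ^ D i)%:R <= (1 + c i / (M i)%:R) ^+ 2.
Proof.
rewrite -subr_ge0 factorE divr_ge0 ?exprn_ge0 ?ler0n //.
by rewrite mulr_ge0 ?(ltW (c_gt0 i)) // subr_ge0 ler_nat.
Qed.

Let sum_lcm_ge (S : {set 'I_t}) : \prod_(i in S) (c i / (M i)%:R) <= \prod_(i in S) c i / (lcmS S)%:R
  ?= iff (lcmS S == prodS S).
Proof.
have cS : 0 < \prod_(i in S) c i by apply: prodr_gt0.
rewrite big_split /= prodfV -natr_prod -/(prodS S); split.
  rewrite ler_pM2l // lef_pV2 ?posrE ?ltr0n // ler_nat dvdn_leq //.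
  exact: biglcm_dvd_prod.
rewrite (inj_eq (mulfI (lt0r_neq0 cS))) (inj_eq invr_inj) eqr_nat.
exact: eq_sym.
Qed.

(* The left side of [count], divided by [N], is the number of orbits; expanding
   the product over subsets bounds it below by [\prod_i (1 + c i / M i)],
   which is in turn at least [p ^ n]. *)
Lemma orbit_count_extremal :
  (forall S : {set 'I_t}, \big[lcmn/1]_(i in S) M i = \prod_(i in S) M i)%N
  /\ (forall i, (M i).-1 ^ 2 = p ^ D i)%N.
Proof.
have P_ge0 i : 0 <= 1 + c i / (M i)%:R by rewrite addr_ge0 // divr_ge0 // ltW.
have fac_ge1 i : 0 < (p ^ D i)%:R :> rat by rewrite ltr0n expn_gt0 (ltnW p_gt1).
have prodD : \prod_i (p ^ D i)%:R = ((p ^ n)%:R : rat) ^+ 2.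
  by rewrite -natr_prod -expn_sum sumD -natrX -expnM muln2 addnn.
(* Squares are compared because the [D i] add up to [2n] and not to [n]. *)
have ge_n : (p ^ n)%:R <= \prod_i (1 + c i / (M i)%:R).
  rewrite -(@ler_pXn2r _ 2) ?nnegrE ?ler0n ?prodr_ge0 //.
  by rewrite -prodD -prodrXl ler_prod // => i _; rewrite ltW //= factor_ge.
have le_n : \prod_i (1 + c i / (M i)%:R) <= (p ^ n)%:R
     ?= iff [forall S in predT, lcmS S == prodS S].
  by rewrite expand -sum_lcm; apply: leif_sum => S _; apply: sum_lcm_ge.
have eq_n : \prod_i (1 + c i / (M i)%:R) = (p ^ n)%:R.
  by apply/eqP; rewrite eq_le ge_n le_n.
split=> [S | i].
  apply/eqP; move: (le_n.2); rewrite eq_n eqxx => /esym/forall_inP.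
  exact.
suff : (1 + c i / (M i)%:R) ^+ 2 - (p ^ D i)%:R = 0.
  rewrite factorE => /eqP; rewrite mulf_eq0 invr_eq0 expf_eq0 pnatr_eq0 /=.
  rewrite -[M i == 0]negbK -lt0n M_gt0 orbF mulf_eq0 (gt_eqF (c_gt0 i)) orbF.
  by rewrite subr_eq0 eqr_nat => /eqP.
(* The two sides have equal products over all indices; bounding the factors other than [i] from
   below and cancelling them gives the missing inequality at [i]. *)
apply/eqP; rewrite subr_eq0 eq_le factor_ge andbT.
have : (p ^ n)%:R ^+ 2 = \prod_i (1 + c i / (M i)%:R) ^+ 2.
  by rewrite prodrXl eq_n.
rewrite -prodD (bigD1 i) //= [RHS](bigD1 i) //= => eqP.
have gt0 : 0 < \prod_(j < t | j != i) (p ^ D j)%:R :> rat by apply: prodr_gt0.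
rewrite -(ler_pM2r gt0) eqP ler_wpM2l ?exprn_ge0 //.
by apply: ler_prod => j _; rewrite ltW //= factor_ge.
Qed.

End OrbitCount.

(** * Diagonalizable matrices *)

Section Diagonal.
Import GRing.Theory.
Local Open Scope ring_scope.

Lemma exprSmx (R : pzRingType) m (A : 'M[R]_m) k : A ^+ k.+1 = A *m A ^+ k.
Proof. exact: exprS. Qed.

Lemma finite_order_diag (L : closedFieldType) m (A : 'M[L]_m) N :
    N%:R != 0 :> L -> A ^+ N = 1%:M ->
  exists2 P, P \in unitmx & exists d, P *m A = diag_mx d *m P.
Proof.
move=> N0; case: m => [|m] in A * => AN.
  by exists 1%:M; [exact: unitmx1 | exists 0; rewrite !thinmx0].
have [|P Pu /diagonalizable_forPex[d /(simmxP Pu) PA]] := (mxpoly.diagonalizableP A).2;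
  last by exists P; last exists d.
have [rs defX] := closed_field_poly_normal ('X^N - 1 : {poly L}).
have N_gt0 : (0 < N)%N by case: (N) N0; rewrite ?eqxx.
move: defX; rewrite lead_coefXnsubC // scale1r => defX.
exists rs; first by rewrite -separable_prod_XsubC -defX separable_Xn_sub_1.
rewrite -defX mxminpoly_min // rmorphB rmorphXn /= horner_mx_X rmorph1 AN.
exact: subrr.
Qed.

Lemma rank_diag_mx (F : fieldType) m (d : 'rV[F]_m) :
  \rank (diag_mx d) = #|[set i | d 0 i != 0]|.
Proof.
(* [U] selects the coordinates in [S]: [diag_mx d] factors through dimension [#|S|], and its
   compression by [U] is the invertible [diag_mx e]. This gives both inequalities. *)
set S := [set i | _]; pose U : 'M[F]_(#|S|, m) := \matrix_(i, j) (j == enum_val i)%:R.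
pose e := \row_i d 0 (enum_val i : 'I_m) : 'rV_#|S|.
have e0 i : e 0 i != 0 by rewrite mxE; have := enum_valP i; rewrite inE.
have UdU : U *m diag_mx d *m U^T = diag_mx e.
  apply/matrixP => i j; rewrite mul_mx_diag !mxE.
  rewrite (bigD1 (enum_val i)) //= big1 => [|k /negPf ki]; last by rewrite !mxE ki mul0r mul0r.
  by rewrite !mxE eqxx mul1r addr0 (inj_eq enum_val_inj) mulr_natr.
have dU : diag_mx d = U^T *m (diag_mx e *m U).
  apply/matrixP => i j; rewrite mul_diag_mx !mxE.
  under eq_bigr do rewrite !mxE.
  have [Si | ] := boolP (i \in S); last first.
    rewrite inE negbK => /eqP di0; rewrite di0 mul0rn big1 // => k _.
    have [ik|_] := eqVneq i (enum_val k); last by rewrite mul0r.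
    by have := enum_valP k; rewrite -ik inE di0 eqxx.
  rewrite (bigD1 (enum_rank_in Si i)) //= big1 => [|k ki]; last first.
    have [ik|_] := eqVneq i (enum_val k); last by rewrite mul0r.
    by rewrite {2}ik enum_valK_in eqxx in ki.
  by rewrite enum_rankK_in // eqxx mul1r addr0 eq_sym mulr_natr.
apply/eqP; rewrite eqn_leq {1}dU (leq_trans (mxrankM_maxr _ _)) ?mulmx_max_rank //=.
pose e' := diag_mx (\row_i (e 0 i)^-1).
apply: (@mulmx1_min_rank _ _ _ _ _ U (U^T *m e')).
rewrite mulmxA UdU mulmx_diag -[1%:M]diag_const_mx; congr diag_mx.
by apply/rowP => i; have := e0 i; rewrite !mxE => di; rewrite divff.
Qed.

Section Spectrum.
Variables (F : fieldType) (m : nat) (A P : 'M[F]_m) (d : 'rV[F]_m).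
Hypotheses (Pu : P \in unitmx) (PA : P *m A = diag_mx d *m P).

Lemma diag_mxX k : P *m A ^+ k = diag_mx (\row_i d 0 i ^+ k) *m P.
Proof.
elim: k => [|k IHk].
  rewrite expr0 mulmx1 (_ : \row_i _ = const_mx 1) ?diag_const_mx ?mul1mx //.
  by apply/rowP => i; rewrite !mxE.
rewrite exprSmx mulmxA PA -mulmxA IHk mulmxA mulmx_diag; congr (diag_mx _ *m P).
by apply/rowP => i; rewrite !mxE exprS.
Qed.

Lemma diag_order N : A ^+ N = 1%:M -> forall i, d 0 i ^+ N = 1.
Proof.
move=> AN i; have := diag_mxX N; rewrite AN mulmx1 -{1}[P]mul1mx => /(can_inj (mulmxK Pu)).
by move/matrixP/(_ i i); rewrite !mxE !eqxx !mulr1n.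
Qed.

Lemma order_diag N : (forall i, d 0 i ^+ N = 1) -> A ^+ N = 1%:M.
Proof.
move=> dN; apply: (can_inj (mulKmx Pu)); rewrite diag_mxX mulmx1.
rewrite (_ : \row_i _ = const_mx 1) ?diag_const_mx ?mul1mx //.
by apply/rowP => i; rewrite !mxE.
Qed.

Lemma eigen_row i : row i P *m A = d 0 i *: row i P.
Proof. by rewrite -row_mul PA row_mul row_diag_mx -scalemxAl -rowE. Qed.

Lemma eigen_diag (v : 'rV[F]_m) a : v != 0 -> v *m A = a *: v -> exists i, d 0 i = a.
Proof.
move=> v0 vA; have [u defv] : exists u, v = u *m P by exists (v *m invmx P); rewrite mulmxKV.
have uD : u *m diag_mx d = a *: u.
  by apply: (can_inj (mulmxK Pu)); rewrite -mulmxA -PA mulmxA -defv vA -scalemxAl -defv.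
have /rV0Pn[i ui] : u != 0 by apply: contraNneq v0 => u0; rewrite defv u0 mul0mx.
exists i; move/matrixP/(_ 0 i): uD; rewrite mul_mx_diag !mxE mulrC.
exact: mulIf.
Qed.

Lemma mxtrace_diag k : \tr (A ^+ k) = \sum_i d 0 i ^+ k.
Proof.
have -> : A ^+ k = invmx P *m (diag_mx (\row_i d 0 i ^+ k) *m P) by rewrite -diag_mxX mulKmx.
rewrite mxtrace_mulC -mulmxA mulmxV // mulmx1 mxtrace_diag.
by apply: eq_bigr => i _; rewrite mxE.
Qed.

Lemma char_poly_diag : char_poly A = \prod_i ('X - (d 0 i)%:P).
Proof.
have <- : char_poly (diag_mx d) = \prod_i ('X - (d 0 i)%:P).
  rewrite char_poly_trig ?diag_mx_is_trig //.
  by apply: eq_bigr => i _; rewrite mxE eqxx mulr1n.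
pose Q := map_mx polyC P.
have QA : Q *m char_poly_mx A = char_poly_mx (diag_mx d) *m Q.
  by rewrite mulmxBr mulmxBl -!map_mxM PA scalar_mxC.
have Q0 : \det Q != 0.
  by rewrite det_map_mx polyC_eq0 -unitfE -[_ \is a _]unitmxE.
by apply: (mulfI Q0); rewrite /char_poly -det_mulmx QA det_mulmx mulrC.
Qed.

Lemma commute_diag X : injective (d 0) -> X *m A = A *m X ->
  exists q, P *m X = diag_mx q *m P.
Proof.
move=> d_inj XA; pose Y := P *m X *m invmx P.
have YD : Y *m diag_mx d = diag_mx d *m Y.
  have -> : diag_mx d = P *m A *m invmx P by rewrite PA mulmxK.
  by rewrite /Y !mulmxA !mulmxKV // -!(mulmxA P) XA.
exists (\row_i Y i i); rewrite -[P *m X](mulmxKV Pu) -/Y; congr (_ *m _).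
apply/matrixP => i j; move/matrixP/(_ i j): YD.
rewrite mul_mx_diag mul_diag_mx !mxE mulrC => /eqP.
have [-> _ | ij] := eqVneq i j; first by rewrite mulr1n.
rewrite -subr_eq0 -mulrBl mulf_eq0 subr_eq0 (inj_eq d_inj) eq_sym (negPf ij) /=.
by rewrite mulr0n => /eqP.
Qed.

Lemma simple_spectrum_inj : (forall a, eigenvalue A a -> mup a (char_poly A) = 1%N) ->
  injective (d 0).
Proof.
move=> ss i j dij; have /ss : eigenvalue A (d 0 i).
  apply/eigenvalueP; exists (row i P); first exact: eigen_row.
  apply: contraTneq Pu => /(congr1 (fun v => v *m invmx P)).
  rewrite mul0mx -row_mul mulmxV // => /matrixP/(_ 0 i); rewrite !mxE eqxx => /eqP.
  by rewrite oner_eq0.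
rewrite char_poly_diag -(big_map (d 0) xpredT (fun a => 'X - a%:P)) mu_prod_XsubC.
move=> c1; apply/eqP; apply/negPn/negP => ij; move: c1.
rewrite count_map (eq_count (a2 := fun k => d 0 k == d 0 i)) //.
rewrite -sum1_count (sum1_card [pred k | d 0 k == d 0 i]).
move/eqP; apply/negP; rewrite neq_ltn; apply/orP; right.
by rewrite (cardD1 i) (cardD1 j) !inE dij eqxx eq_sym ij.
Qed.

Lemma mxrank_fixed k : \rank (kermx (A ^+ k - 1%:M)) = #|[set i | d 0 i ^+ k == 1]|.
Proof.
have Pfull : row_full P by rewrite row_full_unit.
have Pfree : row_free P by rewrite row_free_unit.
have PB : P *m (A ^+ k - 1%:M) = diag_mx (\row_i (d 0 i ^+ k - 1)) *m P.
  rewrite mulmxBr mulmx1 diag_mxX -{2}[P]mul1mx -mulmxBl; congr (_ *m P).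
  by apply/matrixP => i j; rewrite !mxE -mulrnBl.
rewrite mxrank_ker -(eqmxMfull _ Pfull) PB mxrankMfree // rank_diag_mx.
have -> : [set i | (\row_i (d 0 i ^+ k - 1)) 0 i != 0] = ~: [set i | d 0 i ^+ k == 1].
  by apply/setP => i; rewrite !inE mxE subr_eq0.
by rewrite -{1}(card_ord m) -(cardsC [set i | d 0 i ^+ k == 1]) addnK.
Qed.

End Spectrum.
End Diagonal.

(** * Spectra of symplectic matrices *)

(** Origin of the shape of the orders: with [x = M - 1], comparing p-adic valuations makes [D] even
    and yields [M = p ^ a + 1] for [a = D / 2]. *)
Lemma sqr_eq_prime_expn (p x D : nat) : prime p -> (x ^ 2 = p ^ D)%N ->
  (D = D./2 + D./2)%N /\ x = (p ^ D./2)%N.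
Proof.
move=> p_pr xD; have := congr1 (logn p) xD.
rewrite lognX pfactorK // mul2n => defD.
have hD : D./2 = logn p x by rewrite -defD doubleK.
rewrite hD addnn defD; split=> //.
apply/eqP; rewrite -(@eqn_exp2r _ _ 2) // xD -defD -expnM muln2.
exact: eqxx.
Qed.

Section PrimePowerOrder.
Variables (p M : nat).
Hypotheses (p_pr : prime p) (M_gt0 : (0 < M)%N) (copM : coprime p M).

Lemma expn_order_exists : exists2 f, (0 < f)%N & p ^ f = 1 %[mod M].
Proof.
by exists (totient M); rewrite ?totient_gt0 //; apply: Euler_exp_totient.
Qed.

(** [f] is the multiplicative order of [p] modulo [M] (1 if [M = 1]), which is the length of the
    Frobenius orbit of a root of unity of order [M]. *)
Lemma expn_orderP : exists f, [/\ (0 < f)%N, p ^ f = 1 %[mod M]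
  & forall k, p ^ k = 1 %[mod M] -> (f %| k)%N].
Proof.
have ex : exists f, (0 < f)%N && (p ^ f == 1 %[mod M]).
  by have [f f0 fM] := expn_order_exists; exists f; rewrite f0; apply/eqP.
have [f /andP[f0 /eqP fM] fmin] := ex_minnP ex; exists f; split=> // k kM.
rewrite /dvdn eqn0Ngt; apply/negP => k0.
suff : (f <= k %% f)%N by rewrite leqNgt ltn_pmod.
have pk : (p ^ k = (p ^ f) ^ (k %/ f) * p ^ (k %% f))%N.
  by rewrite -expnM [(f * _)%N]mulnC -expnD -divn_eq.
apply: fmin; rewrite k0; apply/eqP; rewrite -kM pk.
by rewrite -modnMml -(modnXm _ _ (p ^ f)) fM modnXm exp1n modnMml mul1n.
Qed.

End PrimePowerOrder.

Section SymplecticSpectrum.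
Import GRing.Theory.
Local Open Scope ring_scope.

Section Form.
Variables (F : fieldType) (n : nat).

Lemma symp_form_unit : symp_form F n \in unitmx.
Proof.
have : symp_form F n *m (symp_form F n)^T = 1%:M.
  rewrite /symp_form tr_block_mx mulmx_block !trmx0 linearN /= trmx1.
  by rewrite !(mul0mx, mulmx0, mul1mx, mulmx1, add0r, addr0, mulNmx, mulmxN, opprK) -scalar_mx_block.
by case/mulmx1_unit.
Qed.

Variables (A P : 'M[F]_(n + n)) (d : 'rV[F]_(n + n)).
Hypotheses (Pu : P \in unitmx) (PA : P *m A = diag_mx d *m P) (sA : symplectic A).

(** Gram matrix of the standard form in the eigenbasis given by the rows of [P]. *)
Definition eigen_form := P *m symp_form F n *m P^T.

(** [A] preserves the form, while applying it to the i-th and j-th eigenvectors multiplies their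
    pairing by [d 0 i * d 0 j]. *)
Lemma eigen_form_inv i j : eigen_form i j != 0 -> d 0 i * d 0 j = 1.
Proof.
have DJ : diag_mx d *m eigen_form *m diag_mx d = eigen_form.
  transitivity (P *m A *m symp_form F n *m (P *m A)^T).
    by rewrite PA trmx_mul tr_diag_mx !mulmxA.
  by rewrite trmx_mul /eigen_form -[in RHS]sA !mulmxA.
move/matrixP/(_ i j): DJ; rewrite mul_mx_diag mul_diag_mx !mxE => DJ J0.
by apply: (mulIf J0); rewrite mul1r -[RHS]DJ mulrAC.
Qed.

Lemma eigen_form_unit : eigen_form \in unitmx.
Proof. by rewrite !unitmx_mul unitmx_tr Pu symp_form_unit. Qed.

Lemma eigen_form_row i : exists j, eigen_form i j != 0.
Proof.
have : row i eigen_form != 0.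
  apply/eqP => r0; have := congr1 (mulmx^~ (invmx eigen_form)) r0.
  rewrite -row_mul mulmxV ?eigen_form_unit // mul0mx => /matrixP/(_ 0 i).
  by rewrite !mxE eqxx => /eqP; rewrite oner_eq0.
by case/rV0Pn => j; rewrite mxE; exists j.
Qed.

Lemma eigenvalue_inv i : exists j, d 0 j = (d 0 i)^-1.
Proof.
have [j /eigen_form_inv dij] := eigen_form_row i; exists j.
have di0 : d 0 i != 0 by apply: contra_eq_neq dij => ->; rewrite mul0r eq_sym oner_eq0.
by apply: (mulfI di0); rewrite dij divff.
Qed.

End Form.

Section Frobenius.
Variables (p : nat) (p_pr : prime p) (L : fieldType) (iota : {rmorphism 'F_p -> L}).

Lemma pchar_ext : p \in [char L].
Proof. by rewrite (fmorph_pchar iota) pchar_Fp. Qed.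

Lemma frob_Fp x : iota x ^+ p = iota x.
Proof.
rewrite -rmorphXn /=; congr (iota _).
by have := expf_card x; rewrite card_Fp.
Qed.

Lemma frob_mxM m k l (X : 'M[L]_(m, k)) (Y : 'M[L]_(k, l)) :
  map_mx (fun x => x ^+ p) (X *m Y)
  = map_mx (fun x => x ^+ p) X *m map_mx (fun x => x ^+ p) Y.
Proof.
pose f := pFrobenius_aut pchar_ext.
have fE r s (Z : 'M[L]_(r, s)) : map_mx (fun x => x ^+ p) Z = map_mx f Z.
  by apply/matrixP => i j; rewrite !mxE.
by rewrite !fE map_mxM.
Qed.

Lemma frob_mxFp k l (X : 'M['F_p]_(k, l)) :
  map_mx (fun x => x ^+ p) (map_mx iota X) = map_mx iota X.
Proof. by apply/matrixP => i j; rewrite !mxE frob_Fp. Qed.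

Variables (m : nat) (A : 'M['F_p]_m) (P : 'M[L]_m) (d : 'rV[L]_m).
Hypotheses (Pu : P \in unitmx) (PA : P *m map_mx iota A = diag_mx d *m P).

(** A matrix over the prime field is unchanged by Frobenius, so the eigenvector equation can be
    raised to the power [p] entrywise. [X] is arbitrary because this serves both for [A] and for
    matrices commuting with it. *)
Lemma frob_eigenrow (X : 'M['F_p]_m) (v : 'rV[L]_m) a : v *m map_mx iota X = a *: v ->
  map_mx (fun x => x ^+ p) v *m map_mx iota X = a ^+ p *: map_mx (fun x => x ^+ p) v.
Proof.
move=> vX; rewrite -{1}frob_mxFp -frob_mxM vX.
by apply/matrixP => i j; rewrite !mxE exprMn.
Qed.

Lemma frob_mx_eq0 (v : 'rV[L]_m) : v != 0 -> map_mx (fun x => x ^+ p) v != 0.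
Proof.
by case/rV0Pn => i vi; apply/rV0Pn; exists i; rewrite mxE expf_neq0.
Qed.

Lemma unit_row_neq0 i : row i P != 0.
Proof.
apply: contraTneq Pu => /(congr1 (fun v => v *m invmx P)).
rewrite mul0mx -row_mul => r0; apply/negP => PU; move: r0; rewrite mulmxV //.
by move/matrixP/(_ 0 i); rewrite !mxE eqxx => /eqP; rewrite oner_eq0.
Qed.

Lemma eigenvalue_frob i : exists j, d 0 j = d 0 i ^+ p.
Proof.
apply: (eigen_diag Pu PA (frob_mx_eq0 (unit_row_neq0 i))).
by apply: frob_eigenrow; rewrite (eigen_row PA).
Qed.

End Frobenius.
End SymplecticSpectrum.

(** * Families of roots of unity closed under inversion and Frobenius *)

Section ExtremalSpectrum.
Import GRing.Theory.
Local Open Scope ring_scope.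

Variables (p m n N : nat) (L : fieldType) (lam : 'I_m -> L).
Hypotheses (p_pr : prime p) (N_gt0 : (0 < N)%N) (copN : coprime p N).
Hypothesis lamN : forall i, lam i ^+ N = 1.
Hypothesis lam_frob : forall i, exists j, lam j = lam i ^+ p.
Hypothesis lam_inv : forall i, exists j, lam j = (lam i)^-1.

Let V M := [set j | M.-primitive_root (lam j)].

Let lam_neq0 i : lam i != 0.
Proof.
by apply: contra_eq_neq (lamN i) => ->; rewrite expr0n gtn_eqF // eq_sym oner_eq0.
Qed.

Let frob_iter i k : exists j, lam j = lam i ^+ (p ^ k).
Proof.
elim: k => [|k [j IHk]]; first by exists i; rewrite expn0 expr1.
by have [l lamj] := lam_frob j; exists l; rewrite lamj IHk -exprM expnSr.
Qed.

Let prim_dvdN i M : M.-primitive_root (lam i) -> (M %| N)%N.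
Proof. by move=> prim; rewrite (prim_order_dvd prim) lamN. Qed.

Let copM i M : M.-primitive_root (lam i) -> coprime p M.
Proof. by move/prim_dvdN/coprime_dvdr; apply. Qed.

Let prim_frob i M k : M.-primitive_root (lam i) -> M.-primitive_root (lam i ^+ (p ^ k)).
Proof. by move=> prim; rewrite prim_root_exp_coprime // coprimeXl // (copM prim). Qed.

Let prim_inv M z : M.-primitive_root z -> M.-primitive_root (z^-1 : L).
Proof.
move=> prim; have M_gt0 := prim_order_gt0 prim.
have -> : z^-1 = z ^+ M.-1.
  have z0 : z != 0.
    by apply: contra_eq_neq (prim_expr_order prim) => ->; rewrite expr0n gtn_eqF // eq_sym oner_eq0.
  by apply: (mulfI z0); rewrite divff // -exprS prednK // prim_expr_order.
by rewrite prim_root_exp_coprime // -{2}(prednK M_gt0) coprimenS.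
Qed.

(** [V M] counts indices, hence eigenvalues with multiplicity, so exhibiting distinct values bounds
    its size from below only; distinctness of the [lam i] is not yet known. *)
Let size_prim_seq (s : seq L) M : uniq s -> {in s, forall z, M.-primitive_root z} ->
  {in s, forall z, exists j, lam j = z} -> (size s <= #|V M|)%N.
Proof.
move=> us prims ls; rewrite cardE -(size_map lam); apply: uniq_leq_size => // z sz.
have [j lamj] := ls z sz; apply/mapP; exists j => //.
by rewrite mem_enum inE lamj prims.
Qed.

Section Orbit.
Variables (i : 'I_m) (M f : nat).
Hypotheses (prim : M.-primitive_root (lam i)) (f_gt0 : (0 < f)%N).
Hypotheses (pf : p ^ f = 1 %[mod M]) (fmin : forall k, p ^ k = 1 %[mod M] -> (f %| k)%N).

Definition frob_orbit := [seq lam i ^+ (p ^ k) | k <- seq.iota 0 f].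

Let frobXf k q : lam i ^+ (p ^ (k + f * q)) = lam i ^+ (p ^ k).
Proof.
apply/eqP; rewrite (eq_prim_root_expr prim) expnD expnM; apply/eqP.
by rewrite -modnMmr -modnXm pf modnXm exp1n modnMmr muln1.
Qed.

Let frobf : lam i ^+ (p ^ f) = lam i.
Proof. by have := frobXf 0 1; rewrite add0n muln1 expn0 expr1. Qed.

Let fix_frob k : lam i ^+ (p ^ k) = lam i -> (f %| k)%N.
Proof.
move/eqP; rewrite -[X in _ == X]expr1 (eq_prim_root_expr prim) => /eqP.
exact: fmin.
Qed.

Lemma mem_frob_orbit k : lam i ^+ (p ^ k) \in frob_orbit.
Proof.
apply/mapP; exists (k %% f)%N; first by rewrite mem_iota ltn_pmod.
by rewrite {1}(divn_eq k f) addnC mulnC frobXf.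
Qed.

Lemma frob_orbit_uniq : uniq frob_orbit.
Proof.
rewrite map_inj_in_uniq ?iota_uniq // => k l; rewrite !mem_iota /= !add0n.
wlog kl : k l / (k <= l)%N => [IH kf lf e | kf lf].
  by have [kl|/ltnW lk] := leqP k l; [apply: IH | apply/esym/IH].
(* This power brings the smaller exponent to [p ^ f], which fixes [lam i]; then [f] divides [l - k],
   which is less than [f]. *)
move/(congr1 (fun x => x ^+ (p ^ (f - k)))); rewrite -!exprM -!expnD subnKC 1?ltnW //.
move=> e; have /fix_frob : lam i ^+ (p ^ (l - k + f)) = lam i.
  have -> : (l - k + f = l + (f - k))%N by lia.
  by rewrite -e frobf.
rewrite dvdn_addl //; have [|lk] := posnP (l - k)%N; first by lia.
by move/(dvdn_leq lk); lia.
Qed.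

Lemma prim_frob_orbit : {in frob_orbit, forall z, M.-primitive_root z}.
Proof. by move=> z /mapP[k _ ->]; apply: prim_frob. Qed.

Lemma frob_orbit_eigen : {in frob_orbit, forall z, exists j, lam j = z}.
Proof. by move=> z /mapP[k _ ->]; apply: frob_iter. Qed.

Lemma dvdn_frob_order : (M %| (p ^ f).-1)%N.
Proof.
rewrite -subn1 -eqn_mod_dvd ?expn_gt0 ?prime_gt0 //.
exact/eqP.
Qed.

Lemma leq_frob_orbit : (f <= #|V M|)%N.
Proof.
rewrite -[f](size_iota 0) -(size_map (fun k => lam i ^+ (p ^ k))).
exact: (size_prim_seq frob_orbit_uniq prim_frob_orbit frob_orbit_eigen).
Qed.

(* If the Frobenius orbit of an eigenvalue of order [M] is closed under
   inversion, then [M <= 2] or [M] divides [p ^ f./2 + 1]; otherwise it accounts,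
   with its inverse, for [2 f] eigenvalues of order [M]. *)
Lemma order_le_card : (M.-1 ^ 2 <= p ^ #|V M|)%N.
Proof.
have p_gt1 := prime_gt1 p_pr; have M_gt0 := prim_order_gt0 prim.
have pV : (p ^ f <= p ^ #|V M|)%N by rewrite leq_exp2l // leq_frob_orbit.
have [/mapP[k] | nself] := boolP ((lam i)^-1 \in frob_orbit).
  rewrite mem_iota /= add0n => kf inv_i.
  have Mk : (M %| p ^ k + 1)%N.
    by rewrite (prim_order_dvd prim) addn1 exprSr -inv_i mulVf.
  have /fix_frob : lam i ^+ (p ^ (k + k)) = lam i.
    by rewrite expnD exprM -inv_i exprVn -inv_i invrK.
  have [k0 _ | k_gt0] := posnP k.
    have : (M <= 2)%N by move: Mk; rewrite k0 expn0; apply: dvdn_leq.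
    rewrite -ltnS -(prednK M_gt0) !ltnS => M1.
    by rewrite (@leq_trans 1) ?expn_gt0 ?prime_gt0 // -(exp1n 2) leq_exp2r.
  (* As [0 < k < f] and [f] divides [2k], only [f = 2k] is left, so [(M - 1) ^ 2] is at most
     [p ^ (2k) = p ^ f]. *)
  move=> dvd_f; have defk : (k + k = f)%N.
    case/dvdnP: dvd_f => -[|[|q]]; nia.
  rewrite (leq_trans _ pV) // -defk addnn -muln2 expnM leq_exp2r //.
  by have := dvdn_leq _ Mk; rewrite addn1 => /(_ isT); lia.
have Mf : (M <= (p ^ f).-1)%N.
  by rewrite dvdn_leq ?dvdn_frob_order // -ltnS prednK ?expn_gt0 ?(ltnW p_gt1) // -[X in (X < _)%N](expn0 p) ltn_exp2l.
have V2 : (f + f <= #|V M|)%N.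
  have := @size_prim_seq (frob_orbit ++ map GRing.inv frob_orbit) M.
  rewrite size_cat !size_map size_iota; apply.
  - rewrite cat_uniq frob_orbit_uniq (map_inj_uniq invr_inj) frob_orbit_uniq andbT /=.
    apply/hasPn => _ /mapP[_ /mapP[k + ->] ->]; rewrite mem_iota /= add0n => kf.
    apply: contra nself => /mapP[l _ e].
    (* If the orbit met its inverse, applying the Frobenius [f - k] more times would put the inverse
       of [lam i] itself in the orbit. *)
    have -> : (lam i)^-1 = lam i ^+ (p ^ (l + (f - k))).
      by rewrite expnD exprM -e exprVn -exprM -expnD subnKC 1?ltnW // frobf.
    exact: mem_frob_orbit.
  - move=> z; rewrite mem_cat => /orP[/prim_frob_orbit // | /mapP[w ow ->]].
    exact/prim_inv/prim_frob_orbit.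
  move=> z; rewrite mem_cat => /orP[/frob_orbit_eigen // | /mapP[w ow ->]].
  by have [j lamj] := frob_orbit_eigen ow; rewrite -lamj; apply: lam_inv.
apply: (@leq_trans (p ^ (f + f))); last by rewrite leq_exp2l.
by rewrite addnn -muln2 expnM leq_exp2r //; lia.
Qed.

(** [p] has order exactly [2a] modulo [p ^ a + 1]: [f] divides [2a], and [M <= p ^ f - 1] excludes
    [f <= a]. One Frobenius orbit then provides [2a] distinct values, which exhaust the [2a] indices
    in [V M]. *)
Lemma order_extremal a : (0 < a)%N -> M = (p ^ a + 1)%N -> #|V M| = (a + a)%N ->
  {in V M &, injective lam} /\ {in V M, forall j, lam j \in frob_orbit}.
Proof.
move=> a_gt0 defM cardV; have p_gt1 := prime_gt1 p_pr.
have af : (a < f)%N.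
  have : (M <= (p ^ f).-1)%N.
    by rewrite dvdn_leq ?dvdn_frob_order // -ltnS prednK ?expn_gt0 ?(ltnW p_gt1) // -[X in (X < _)%N](expn0 p) ltn_exp2l.
  by rewrite defM => le; rewrite -(ltn_exp2l _ _ p_gt1); lia.
have deff : f = (a + a)%N.
  have : (f %| a + a)%N.
    apply: fmin; rewrite defM; apply/eqP; rewrite eqn_mod_dvd ?expn_gt0 ?(ltnW p_gt1) //.
    by rewrite addnn -muln2 expnM -[X in (_ - X)%N](exp1n 2) subn_sqr dvdn_mull.
  case/dvdnP => -[|[|q]]; nia.
have sub : {subset frob_orbit <= map lam (enum (V M))}.
  move=> z oz; have [j lamj] := frob_orbit_eigen oz; apply/mapP; exists j => //.
  by rewrite mem_enum inE lamj prim_frob_orbit.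
have le : (size (map lam (enum (V M))) <= size frob_orbit)%N.
  by rewrite !size_map -cardE size_iota deff cardV.
have [_ eqi] := uniq_min_size frob_orbit_uniq sub le; split=> [|j Vj].
  exact/dinjectiveP/(leq_size_uniq frob_orbit_uniq sub le).
by rewrite eqi map_f // mem_enum.
Qed.

End Orbit.

Hypothesis mE : m = (n + n)%N.
Hypothesis count : (\sum_(k < N) p ^ #|[set i | lam i ^+ k == 1%R]| = N * p ^ n)%N.

Let prim_uniq M M' z : M.-primitive_root (z : L) -> M'.-primitive_root z -> M = M'.
Proof.
move=> prim prim'; apply/eqP; rewrite eqn_dvd (prim_order_dvd prim) (prim_order_dvd prim').
by rewrite !prim_expr_order ?eqxx.
Qed.

(** The last clause, conjugacy under Frobenius of eigenvalues of equal order, is what later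
    determines a commuting matrix from one eigenvalue per order. *)
Theorem extremal_spectrum : exists (t : nat) (a : 'I_t -> nat),
  [/\ (forall i j : 'I_t, (i < j)%N -> (a j < a i)%N) /\ (forall i, (1 <= a i)%N),
      n = (\sum_(i < t) a i)%N,
      (forall i j : 'I_t, i != j -> coprime (p ^ a i + 1) (p ^ a j + 1)) /\
      (\big[lcmn/1]_(i < t) (p ^ a i + 1) = \prod_(i < t) (p ^ a i + 1))%N,
      [/\ injective lam, forall i, exists j, (p ^ a j + 1).-primitive_root (lam i)
        & forall j, exists i, (p ^ a j + 1).-primitive_root (lam i)]
    & forall i j M, M.-primitive_root (lam i) -> M.-primitive_root (lam j) ->
        exists k, lam j = lam i ^+ (p ^ k)].
Proof.
have p_gt1 := prime_gt1 p_pr.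
have [o prim_o] : exists o : 'I_m -> nat, forall i, (o i).-primitive_root (lam i).
  apply: (@fin_all_exists _ (fun _ => nat) (fun i M => M.-primitive_root (lam i))) => i.
  by have [M prim _] := prim_order_exists N_gt0 (lamN i); exists M.
(* Sorting the orders decreasingly gives the required [a_1 > ... > a_t], since [p ^ a + 1] increases
   with [a]. *)
pose os := sort geq (undup [seq o i | i <- enum 'I_m]).
pose t := size os; pose M (j : 'I_t) := nth 0%N os j.
have os_sorted : sorted gtn os.
  by rewrite gtn_sorted_uniq_geq sort_uniq undup_uniq sort_sorted.
have M_decr (i j : 'I_t) : (i < j)%N -> (M j < M i)%N.
  move=> ij; apply: (sorted_ltn_nth _ 0%N os_sorted) ij; rewrite ?inE ?ltn_ord //.
  by move=> x y z /= xy yz; apply: ltn_trans xy.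
have M_inj : injective M.
  move=> i j Mij; apply/val_inj; have [/M_decr|/M_decr|//] := ltngtP i j; rewrite Mij ltnn //.
have oM j : exists i, o i = M j.
  have : M j \in os by rewrite mem_nth.
  by rewrite mem_sort mem_undup => /mapP[i _ ->]; exists i.
have [r rM] : exists r : 'I_m -> 'I_t, forall i, M (r i) = o i.
  apply: (@fin_all_exists _ (fun _ => 'I_t) (fun i j => M j = o i)) => i.
  have os_o : o i \in os by rewrite mem_sort mem_undup map_f ?mem_enum.
  have lt : (index (o i) os < t)%N by rewrite index_mem.
  by exists (Ordinal lt); rewrite /M nth_index.
have VE j : V (M j) = [set i | r i == j].
  apply/setP => i; rewrite !inE -(inj_eq M_inj) rM.
  apply/idP/eqP => [prim | <-]; last exact: prim_o.
  exact: prim_uniq (prim_o i) prim.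
pose D j := #|V (M j)|.
have orb j : exists i f, [/\ (M j).-primitive_root (lam i), (0 < f)%N,
    p ^ f = 1 %[mod M j] & forall k, p ^ k = 1 %[mod M j] -> (f %| k)%N].
  have [i oi] := oM j; have prim := prim_o i; rewrite oi in prim.
  have [f [f0 fM fmin]] := expn_orderP (prim_order_gt0 prim) (copM prim).
  by exists i, f.
have dvdMN j : (M j %| N)%N by have [i oi] := oM j; rewrite -oi; apply: prim_dvdN.
have D_gt0 j : (0 < D j)%N.
  by have [i oi] := oM j; apply/card_gt0P; exists i; rewrite inE -oi.
have card_part (B : pred 'I_m) : #|[set i | B i]| = (\sum_(j < t) \sum_(i | r i == j) B i)%N.
  rewrite -sum1_card big_mkcond (partition_big r predT) //=.
  by apply: eq_bigr => j _; apply: eq_bigr => i _; rewrite inE; case: (B i).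
have sumD : (\sum_j D j = n + n)%N.
  rewrite -mE -[RHS]card_ord -cardsT -(eq_card (A := [set i | true])) => [|i]; last by rewrite !inE.
  rewrite card_part; apply: eq_bigr => j _.
  by rewrite /D VE -sum1_card; apply: eq_bigl => i; rewrite inE.
have leMD j : ((M j).-1 ^ 2 <= p ^ D j)%N.
  by have [i [f [prim f0 fM fmin]]] := orb j; apply: (order_le_card prim f0 fM fmin).
have countM : (\sum_(k < N) \prod_j (if M j %| k then p ^ D j else 1) = N * p ^ n)%N.
  rewrite -count; apply: eq_bigr => k _; rewrite card_part expn_sum.
  apply: eq_bigr => j _.
  have -> : (\sum_(i | r i == j) (lam i ^+ k == 1%R) = (M j %| k) * D j)%N.
    rewrite /D VE -sum1_card big_distrr /=; apply: eq_big => [i|i /eqP rij]; first by rewrite inE.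
    by rewrite -(prim_order_dvd (prim_o i)) -rM rij muln1.
  by case: (M j %| k)%N; rewrite ?mul1n ?mul0n.
have [lcmM sqrM] := orbit_count_extremal N_gt0 dvdMN p_gt1 D_gt0 sumD leMD countM.
pose a j := (D j)./2.
have DE j : D j = (a j + a j)%N by have [] := sqr_eq_prime_expn p_pr (sqrM j).
have a_gt0 j : (1 <= a j)%N by have := D_gt0 j; rewrite DE; lia.
have ME j : M j = (p ^ a j + 1)%N.
  have [_ <-] := sqr_eq_prime_expn p_pr (sqrM j).
  by rewrite addn1 prednK // (dvdn_gt0 N_gt0).
have ext i : exists f, {in V (M (r i)) &, injective lam}
    /\ {in V (M (r i)), forall k, lam k \in frob_orbit i f}.
  have prim : (M (r i)).-primitive_root (lam i) by rewrite rM.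
  have [f [f0 fM fmin]] := expn_orderP (prim_order_gt0 prim) (copM prim).
  exists f; exact: (order_extremal prim f0 fM fmin (a_gt0 _) (ME _) (DE _)).
exists t, a; split.
- by split=> // i j /M_decr; rewrite !ME ltn_add2r ltn_exp2l.
- have : (\sum_j a j + \sum_j a j = n + n)%N by rewrite -sumD -big_split; apply: eq_bigr.
  by rewrite !addnn => /double_inj.
(* The equality of lcm and product is used on the set of all indices, for the order of the matrix,
   and on pairs, for coprimality. *)
- split=> [i j ij|]; last first.
    have := lcmM setT; under eq_bigl do rewrite inE; under [in RHS]eq_bigl do rewrite inE.
    by under eq_bigr do rewrite ME; under [in RHS]eq_bigr do rewrite ME.
  have := lcmM [set i; j]; rewrite !big_setU1 ?inE //= !big_set1 !ME => e.
  have := muln_lcm_gcd (p ^ a i + 1) (p ^ a j + 1); rewrite e /coprime.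
  rewrite -[X in _ = X]muln1 => /eqP; rewrite eqn_pmul2l // muln_gt0 !addn1 //.
- split=> [i j lamij | i | j]; last 2 first.
  + by exists (r i); rewrite -ME rM.
  + by have [i oi] := oM j; exists i; rewrite -ME -oi.
  have [f [inj _]] := ext i; apply: inj => //; rewrite VE inE //.
  by rewrite -(inj_eq M_inj) !rM (prim_uniq (prim_o j) (_ : (o i).-primitive_root _)) // -lamij.
move=> i j M0 primi primj; have [f [_ orbi]] := ext i.
have /orbi/mapP[k _ ->] : j \in V (M (r i)); last by exists k.
by rewrite inE rM (prim_uniq (prim_o i) primi).
Qed.

End ExtremalSpectrum.

(** * The torus centralizing a regular element *)

Section CentralizerTorus.
Import GRing.Theory.
Local Open Scope ring_scope.

Variables (F : fieldType) (n : nat).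
Variables (A P : 'M[F]_(n + n)) (d : 'rV[F]_(n + n)).
Hypotheses (Pu : P \in unitmx) (PA : P *m A = diag_mx d *m P) (sA : symplectic A).

Lemma eigen_form_symplectic X q : P *m X = diag_mx q *m P ->
  (forall i j, eigen_form P i j != 0 -> q 0 i * q 0 j = 1) -> symplectic X.
Proof.
move=> PX qJ; rewrite /symplectic.
have DJ : diag_mx q *m eigen_form P *m diag_mx q = eigen_form P.
  apply/matrixP => i j; rewrite mul_mx_diag mul_diag_mx !mxE mulrAC.
  by have [/eqP|/qJ ->] := boolP (eigen_form P i j == 0); rewrite ?mul1r // mxE => ->; rewrite mulr0.
apply: (can_inj (mulKmx Pu)); apply: (can_inj (mulmxK (_ : P^T \in unitmx))).
  by rewrite unitmx_tr.
rewrite -/(eigen_form P) -DJ /eigen_form !mulmxA PX -!mulmxA -trmx_mul PX.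
by rewrite trmx_mul tr_diag_mx !mulmxA.
Qed.

Hypotheses (d_inj : injective (d 0)) (d_sqr : forall i, d 0 i * d 0 i != 1).

Let J := eigen_form P.

(** As the eigenvalues are distinct, each row of the Gram matrix has a single nonzero entry, at the
    inverse eigenvalue; [d_sqr] rules out self-inverse eigenvalues and so fixed points of [tau]. *)
Lemma eigen_involution : exists tau : 'I_(n + n) -> 'I_(n + n),
  [/\ forall i, J i (tau i) != 0, forall i j, J i j != 0 -> j = tau i,
      forall i, tau (tau i) = i & forall i, tau i != i].
Proof.
have [tau Jtau] : exists tau : 'I_(n + n) -> 'I_(n + n), forall i, J i (tau i) != 0.
  apply: (@fin_all_exists _ (fun _ => 'I_(n + n)) (fun i j => J i j != 0)).
  exact: eigen_form_row.
have dtau i : d 0 i * d 0 (tau i) = 1 by apply: (eigen_form_inv PA sA).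
have d0 i : d 0 i != 0 by apply: contra_eq_neq (dtau i) => ->; rewrite mul0r eq_sym oner_eq0.
have tau_uniq i j : J i j != 0 -> j = tau i.
  move/(eigen_form_inv PA sA); rewrite -(dtau i) => /(mulfI (d0 i)).
  exact: d_inj.
exists tau; split=> // i.
  by apply: d_inj; apply: (mulfI (d0 (tau i))); rewrite dtau mulrC dtau.
by apply: contra_eq_neq (dtau i) => ->.
Qed.

(* The eigenvalues of [A] being distinct, this is a torus: in a basis of
   eigenvectors it consists of the diagonal matrices with inverse entries at
   inverse eigenvalues. *)
Definition cent_symp (X : 'M[F]_(n + n)) := symplectic X /\ X *m A = A *m X.

Lemma cent_symp_torus : torus cent_symp.
Proof.
have [tau [Jtau tau_uniq tauK tau_neq]] := eigen_involution.
(* [D] takes one index from each pair [{i, tau i}]; these are the free parameters of the torus. *)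
pose D := [set i : 'I_(n + n) | (i < tau i)%N].
have D_tau i : (tau i \in D) = (i \notin D).
  have neq : (tau i != i :> nat) by apply: contra (tau_neq i) => /eqP/val_inj ->.
  by rewrite !inE tauK -leqNgt ltn_neqAle neq.
pose e (j : 'I_#|D|) : 'I_(n + n) := enum_val j.
have De j : e j \in D by apply: enum_valP.
have eP i : i \in D -> exists j, i = e j.
  by move=> Di; exists (enum_rank_in Di i); rewrite /e enum_rankK_in.
(* The parameter [t 0 j] appears with exponent 1 at [e j] and exponent -1 at its partner
   [tau (e j)]. *)
pose E i j : int := (i == e j)%:Z - (tau i == e j)%:Z.
pose chi (t : 'rV[F]_#|D|) i := \prod_j t 0 j ^ E i j.
pose dchi t := diag_mx (\row_i chi t i).
pose phi t := invmx P *m dchi t *m P.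
pose psi (X : 'M[F]_(n + n)) := \row_j (P *m X *m invmx P) (e j) (e j).
have chi_neq0 t i : in_Gm t -> chi t i != 0.
  by move=> tG; apply/prodf_neq0 => j _; rewrite expfz_neq0.
have chiM s t i : in_Gm s -> in_Gm t -> chi (map2_mx *%R s t) i = chi s i * chi t i.
  move=> sG tG; rewrite /chi -big_split; apply: eq_bigr => j _.
  by rewrite mxE /= expfzMl.
have chi_tau t i : chi t (tau i) = (chi t i)^-1.
  rewrite /chi -prodfV; apply: eq_bigr => j _.
  by rewrite invr_expz; congr (_ ^ _); rewrite /E tauK opprB.
have chi_e t j : chi t (e j) = t 0 j.
  rewrite /chi (bigD1 j) //= big1 => [|k kj].
    rewrite /E eqxx (negPf (_ : tau (e j) != e j)) ?tau_neq //.
    by rewrite subr0 expr1z mulr1.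
  rewrite /E (inj_eq enum_val_inj) eq_sym (negPf kj).
  suff /negPf -> : tau (e j) != e k by rewrite subr0 expr0z.
  by apply: contraTneq (De k) => <-; rewrite D_tau negbK.
have Pphi t : P *m phi t = dchi t *m P by rewrite /phi !mulmxA mulmxV // mul1mx.
exists #|D|, phi, psi; split.
- split=> [t tG | s t sG tG].
    rewrite !unitmx_mul unitmx_inv Pu andbT /= unitmxE det_diag unitfE.
    by apply/prodf_neq0 => i _; rewrite mxE chi_neq0.
  rewrite /phi !mulmxA mulmxK // -(mulmxA _ (dchi s)) mulmx_diag; congr (_ *m diag_mx _ *m _).
  by apply/rowP => i; rewrite !mxE chiM.
- move=> a b; exists 'I_(n + n), (fun k => invmx P a k * P k b), E => t tG.
  by rewrite mxE; apply: eq_bigr => k _; rewrite mul_mx_diag !mxE mulrAC.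
(* [psi] is linear in the entries of [X]: each monomial is one entry, and the determinant enters
   with exponent 0. *)
- move=> j; pose cf (k : 'I_(n + n) * 'I_(n + n)) := P (e j) k.1 * invmx P k.2 (e j).
  exists ('I_(n + n) * 'I_(n + n))%type, cf, (fun k a b => (a == k.1) && (b == k.2) : nat), 0%N.
  move=> X Xu; rewrite expr0 divr1 !mxE.
  under eq_bigr do rewrite mxE big_distrl /=.
  rewrite exchange_big pair_big /=; apply: eq_bigr => -[a b] _ /=.
  rewrite (bigD1 a) //= (bigD1 b) //= !eqxx expr1 big1 => [|k /negPf ->]; last by rewrite andbF expr0.
  rewrite big1 => [|k /negPf kb]; first by rewrite !mulr1 /cf /= mulrAC.
  by rewrite big1 // => l _; rewrite kb expr0.
- move=> t tG; apply/rowP => j; rewrite mxE Pphi mulmxK // mxE eqxx mulr1n mxE.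
  exact: chi_e.
move=> X; split=> [[sX cX] | [t tG ->{X}]]; last first.
  split; first by apply: (eigen_form_symplectic (Pphi t)) => i j /tau_uniq ->;
    rewrite !mxE chi_tau divff ?chi_neq0.
  apply: (can_inj (mulKmx Pu)); rewrite (mulmxA P (phi t)) Pphi (mulmxA P A) PA.
  rewrite -(mulmxA _ P A) PA -(mulmxA _ P (phi t)) Pphi !mulmxA.
  by congr (_ *m _); apply: diag_mxC.
have [q Pq] := commute_diag Pu PA d_inj cX.
have q_tau i : q 0 i * q 0 (tau i) = 1 by apply: (eigen_form_inv Pq sX).
have q0 i : q 0 i != 0 by apply: contra_eq_neq (q_tau i) => ->; rewrite mul0r eq_sym oner_eq0.
have qV i : q 0 (tau i) = (q 0 i)^-1 by apply: (mulfI (q0 i)); rewrite q_tau divff.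
exists (\row_j q 0 (e j)); first by move=> j; rewrite mxE.
apply: (can_inj (mulKmx Pu)); rewrite Pq Pphi; congr (diag_mx _ *m _).
apply/rowP => i; rewrite mxE; have [/eP[j ->] | ] := boolP (i \in D).
  by rewrite chi_e mxE.
rewrite -D_tau => /eP[j ej]; rewrite -(tauK i) ej chi_tau chi_e qV mxE.
by [].
Qed.

(** A torus containing this one contains [A] and is commutative, being an image of a power of the
    multiplicative group, so it lies in the centralizer of [A]. *)
Lemma cent_symp_max_torus : symp_max_torus cent_symp.
Proof.
split=> [|X [] // | T' [r [phi [psi [[_ phiM] _ _ _ T'E]]]] sT' sub X T'X].
  exact: cent_symp_torus.
split; first exact: sT'.
have /T'E[s sG ->] : T' A by apply: sub.
case/T'E: T'X => t tG ->; rewrite -!phiM //; congr phi.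
by apply/rowP => i; rewrite !mxE mulrC.
Qed.

End CentralizerTorus.

(** * Rational points of the torus *)

Lemma chinese_family t (M k : 'I_t -> nat) :
    (forall i j, i != j -> coprime (M i) (M j)) ->
  exists x, forall j, x = k j %[mod M j].
Proof.
move=> coM; suff [x xP] : exists x, {in index_enum 'I_t, forall j, x = k j %[mod M j]}.
  by exists x => j; apply: xP; rewrite mem_index_enum.
elim: (index_enum _) (index_enum_uniq 'I_t) => [|i r IHr] /=; first by exists 0.
case/andP => ir /IHr[x xP].
have co : coprime (\prod_(j <- r) M j) (M i).
  rewrite big_seq; elim/big_ind: _ => [|y z cy cz|j rj]; first exact: coprime1n.
    by rewrite coprimeMl cy.
  by apply: coM; apply: contraNneq ir => <-.
exists (chinese (\prod_(j <- r) M j) (M i) x (k i)) => j; rewrite inE.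
case/predU1P => [->|rj]; first exact: chinese_modr.
rewrite -xP //; apply/eqP; have dv : M j %| \prod_(j <- r) M j by rewrite (big_rem j) //= dvdn_mulr.
by rewrite -(modn_dvdm _ dv) chinese_modl // (modn_dvdm _ dv).
Qed.

Section RationalPoints.
Import GRing.Theory.
Local Open Scope ring_scope.

Lemma map_symp_form (F F' : fieldType) (f : {rmorphism F -> F'}) n :
  map_mx f (symp_form F n) = symp_form F' n.
Proof. by rewrite /symp_form map_block_mx !map_mx0 map_mxN !map_mx1. Qed.

Lemma map_symplectic (F F' : fieldType) (f : {rmorphism F -> F'}) n (X : 'M[F]_(n + n)) :
  symplectic (map_mx f X) <-> symplectic X.
Proof.
rewrite /symplectic -(map_symp_form f) map_trmx -!map_mxM.
by split=> [/map_mx_inj|->].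
Qed.

Lemma map_mx_comm (F F' : fieldType) (f : {rmorphism F -> F'}) n (X Y : 'M[F]_n) :
  map_mx f X *m map_mx f Y = map_mx f Y *m map_mx f X <-> X *m Y = Y *m X.
Proof. by rewrite -!map_mxM; split=> [/map_mx_inj|->]. Qed.

Lemma map_mxX (F F' : fieldType) (f : {rmorphism F -> F'}) n (X : 'M[F]_n) k :
  map_mx f (X ^+ k) = map_mx f X ^+ k.
Proof.
by elim: k => [|k IHk]; [rewrite !expr0 map_mx1 | rewrite !exprSmx map_mxM IHk].
Qed.

(** [A] has entries in the prime field, so its centralizer over the closure is stable under
    Frobenius, and its points over the prime field are the symplectic matrices commuting with
    [A]. *)
Lemma cent_symp_finite_torus (p n : nat) (p_pr : prime p)
    (A : 'M['F_p]_(n + n)) (P : 'M[Fpbar p]_(n + n)) d (H : {set 'M['F_p]_(n + n)}) :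
    P \in unitmx -> P *m map_mx (@Fp_inj p) A = diag_mx d *m P -> symplectic A ->
    injective (d 0) -> (forall i, d 0 i * d 0 i != 1) ->
    (forall X, X \in H <-> symplectic X /\ X *m A = A *m X) ->
  finite_Sp_max_torus H.
Proof.
move=> Pu PA sA d_inj d_sqr HE; set iota := Fp_inj p in PA *.
pose f : {rmorphism Fpbar p -> Fpbar p} := pFrobenius_aut (pchar_ext p_pr iota).
have fA : map_mx f (map_mx iota A) = map_mx iota A by apply: (frob_mxFp p_pr).
have sA' : symplectic (map_mx iota A) by apply/map_symplectic.
exists (cent_symp (map_mx iota A)); split=> [|X|X].
- exact: cent_symp_max_torus Pu PA sA' d_inj d_sqr.
- rewrite -[map_mx _ X]/(map_mx f X) /cent_symp map_symplectic -[in X in _ <-> X]fA.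
  by rewrite map_mx_comm.
by rewrite /cent_symp map_symplectic map_mx_comm.
Qed.

Section Centralizer.
Variables (p n : nat) (p_pr : prime p) (L : fieldType) (iota : {rmorphism 'F_p -> L}).
Variables (A X : 'M['F_p]_(n + n)) (P : 'M[L]_(n + n)) (d : 'rV[L]_(n + n)).
Hypotheses (Pu : P \in unitmx) (PA : P *m map_mx iota A = diag_mx d *m P).
Hypotheses (sA : symplectic A) (d_inj : injective (d 0)).
Hypotheses (sX : symplectic X) (cX : X *m A = A *m X).

Variables (t : nat) (a : 'I_t -> nat).
Hypothesis cop_a : forall i j, i != j -> coprime (p ^ a i + 1) (p ^ a j + 1).
Hypothesis d_prim : forall i, exists j, (p ^ a j + 1).-primitive_root (d 0 i).
Hypothesis a_prim : forall j, exists i, (p ^ a j + 1).-primitive_root (d 0 i).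
Hypothesis d_orb : forall i j M, M.-primitive_root (d 0 i) -> M.-primitive_root (d 0 j) ->
  exists k, d 0 j = d 0 i ^+ (p ^ k).

(* Commuting with [A], [X] acts on the eigenvectors of [A] by scalars [q i] that
   follow the Frobenius and inversion actions on the eigenvalues.  Hence [q i] is a
   power of an eigenvalue of order [p ^ a + 1], and the exponents are glued by the
   Chinese remainder theorem. *)
Lemma cent_symp_power : exists k, X = A ^+ k.
Proof.
have sA' : symplectic (map_mx iota A) by apply/map_symplectic.
have sX' : symplectic (map_mx iota X) by apply/map_symplectic.
have cX' : map_mx iota X *m map_mx iota A = map_mx iota A *m map_mx iota X by apply/map_mx_comm.
have [q Pq] := commute_diag Pu PA d_inj cX'.
have d0 i : d 0 i != 0.
  have [j prim] := d_prim i; apply: contra_eq_neq (prim_expr_order prim) => ->.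
  by rewrite expr0n addn1 /= eq_sym oner_eq0.
(* Eigenspaces of [A] being lines, [q 0 j] can be read on any eigenvector. This is needed because
   the Frobenius twist of a row of [P] need not be a row of [P]. *)
have q_eigen j (w : 'rV[L]_(n + n)) b : w != 0 -> w *m map_mx iota A = d 0 j *: w ->
    w *m map_mx iota X = b *: w -> q 0 j = b.
  move=> w0 wA wX; have [u defw] : exists u, w = u *m P by exists (w *m invmx P); rewrite mulmxKV.
  have uD : u *m diag_mx d = d 0 j *: u.
    by apply: (can_inj (mulmxK Pu)); rewrite -mulmxA -PA mulmxA -defw wA -scalemxAl -defw.
  have uq : u *m diag_mx q = b *: u.
    by apply: (can_inj (mulmxK Pu)); rewrite -mulmxA -Pq mulmxA -defw wX -scalemxAl -defw.
  have /rV0Pn[i ui] : u != 0 by apply: contraNneq w0 => u0; rewrite defw u0 mul0mx.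
  have ij : i = j.
    by apply: d_inj; move/matrixP/(_ 0 i): uD; rewrite mul_mx_diag !mxE mulrC => /(mulIf ui).
  by move/matrixP/(_ 0 i): uq; rewrite mul_mx_diag !mxE mulrC ij => /(mulIf _) -> //; rewrite -ij.
have q_frob i j : d 0 j = d 0 i ^+ p -> q 0 j = q 0 i ^+ p.
  move=> dij; apply: (q_eigen j (map_mx (fun x => x ^+ p) (row i P))).
  - exact/frob_mx_eq0/unit_row_neq0.
  - by rewrite dij; apply: (frob_eigenrow p_pr); apply: (eigen_row PA).
  by apply: (frob_eigenrow p_pr); apply: (eigen_row Pq).
have q_frobX k i j : d 0 j = d 0 i ^+ (p ^ k) -> q 0 j = q 0 i ^+ (p ^ k).
  elim: k j => [|k IHk] j; first by rewrite expn0 !expr1 => /d_inj ->.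
  move=> dij; have [l dl] : exists l, d 0 l = d 0 i ^+ (p ^ k).
    elim: (k) => [|k' [l dl]]; first by exists i; rewrite expn0 expr1.
    have [l' dl'] := eigenvalue_frob p_pr Pu PA l.
    by exists l'; rewrite dl' dl -exprM expnSr.
  by rewrite (q_frob l j) ?dij ?dl ?(IHk l) // -exprM expnSr.
have q_inv i j : d 0 j = (d 0 i)^-1 -> q 0 j = (q 0 i)^-1.
  move=> dij; have [l Jl] := eigen_form_row Pu i.
  have lj : l = j.
    by apply: d_inj; apply: (mulfI (d0 i)); rewrite dij divff // (eigen_form_inv PA sA' Jl).
  have qij : q 0 i * q 0 j = 1 by rewrite -lj (eigen_form_inv Pq sX' Jl).
  have qi0 : q 0 i != 0 by apply: contra_eq_neq qij => ->; rewrite mul0r eq_sym oner_eq0.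
  by apply: (mulfI qi0); rewrite qij divff.
(* On an eigenvalue of order [p ^ a + 1] inversion is the a-fold Frobenius, so [q ^ (p ^ a)] is the
   inverse of [q], that is [q ^ (p ^ a + 1) = 1]. *)
have q_pow i j : (p ^ a j + 1).-primitive_root (d 0 i) -> exists k, q 0 i = d 0 i ^+ k.
  move=> prim; have [l dl] := eigenvalue_inv Pu PA sA' i.
  have ql : q 0 l = q 0 i ^+ (p ^ a j).
    apply: q_frobX; rewrite dl; apply: (mulfI (d0 i)).
    by rewrite divff // -exprS -[(p ^ a j).+1]addn1 prim_expr_order.
  have qi0 : q 0 i != 0.
    apply/eqP => qi0; have [l' Jl'] := eigen_form_row Pu i.
    have /eqP := eigen_form_inv Pq sX' Jl'.
    by rewrite qi0 mul0r eq_sym oner_eq0.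
  have [|k ->] := prim_rootP prim (_ : q 0 i ^+ (p ^ a j + 1) = 1); last by exists k.
  by rewrite addn1 exprS -ql (q_inv i l dl) divff.
(* One representative eigenvalue per order is enough: the others are its Frobenius conjugates, and
   [q] follows them with the same exponent. *)
have [h hP] : exists h : 'I_t -> 'I_(n + n), forall j, (p ^ a j + 1).-primitive_root (d 0 (h j)).
  exact: (@fin_all_exists _ (fun _ => 'I_(n + n)) (fun j i => (p ^ a j + 1).-primitive_root (d 0 i))).
have [e eP] : exists e : 'I_t -> nat, forall j, q 0 (h j) = d 0 (h j) ^+ e j.
  apply: (@fin_all_exists _ (fun _ => nat) (fun j e => q 0 (h j) = d 0 (h j) ^+ e)) => j.
  exact: q_pow (hP j).
have [k kP] := chinese_family e cop_a.
exists k; apply: (@map_mx_inj _ _ iota); rewrite map_mxX.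
apply: (can_inj (mulKmx Pu)); rewrite Pq (diag_mxX PA); congr (diag_mx _ *m _).
apply/rowP => i; rewrite mxE; have [j prim] := d_prim i.
have [l dl] := d_orb (hP j) prim.
rewrite (q_frobX _ _ _ dl) eP -exprM mulnC exprM -dl; apply/eqP.
by rewrite (eq_prim_root_expr prim) kP.
Qed.

End Centralizer.
End RationalPoints.

(** * Symplectic bases *)

Section SymplecticBasis.
Import GRing.Theory.
Local Open Scope ring_scope.

Variables (F : fieldType) (n : nat) (J : 'M[F]_(n + n)).
Hypotheses (altJ : forall v : 'rV_(n + n), v *m J *m v^T = 0) (Ju : J \in unitmx).

Let B (u v : 'rV[F]_(n + n)) : F := (u *m J *m v^T) 0 0.

Let BDl u v w : B (u + v) w = B u w + B v w.
Proof. by rewrite /B !mulmxDl mxE. Qed.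
Let BDr u v w : B w (u + v) = B w u + B w v.
Proof. by rewrite /B linearD mulmxDr mxE. Qed.
Let BZl a u w : B (a *: u) w = a * B u w.
Proof. by rewrite /B -!scalemxAl mxE. Qed.
Let BZr a u w : B w (a *: u) = a * B w u.
Proof. by rewrite /B linearZ -scalemxAr mxE. Qed.
Let B0l w : B 0 w = 0.
Proof. by rewrite /B !mul0mx mxE. Qed.
Let B0r w : B w 0 = 0.
Proof. by rewrite /B trmx0 mulmx0 mxE. Qed.
Let Bsuml k (u : 'I_k -> 'rV_(n + n)) w : B (\sum_i u i) w = \sum_i B (u i) w.
Proof. by apply: (big_morph (B^~ w)) => [x y|]; rewrite ?BDl ?B0l. Qed.
Let Bsumr k (u : 'I_k -> 'rV_(n + n)) w : B w (\sum_i u i) = \sum_i B w (u i).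
Proof. by apply: (big_morph (B w)) => [x y|]; rewrite ?BDr ?B0r. Qed.
Let Bvv v : B v v = 0.
Proof. by rewrite /B altJ mxE. Qed.
Let BC u v : B u v = - B v u.
Proof.
have := Bvv (u + v); rewrite BDl !BDr !Bvv add0r addr0 => /eqP.
by rewrite addr_eq0 => /eqP.
Qed.

(** [e] and [f] are total functions constrained only below [k], so that an extension overwrites
    their value at [k]. *)
Let partial_basis k := exists e f : 'I_n -> 'rV[F]_(n + n),
  forall i j : 'I_n, (i < k)%N -> (j < k)%N ->
  [/\ B (e i) (e j) = 0, B (f i) (f j) = 0 & B (e i) (f j) = (i == j)%:R].

Let extend_basis k : (k < n)%N -> partial_basis k -> partial_basis k.+1.
Proof.
move=> kn [e [f ef]]; pose c := widen_ord (ltnW kn).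
(* [C] has [2k < 2n] columns, which leaves a nonzero [u] orthogonal to all pairs found so far. *)
pose C := row_mx (\matrix_(i < n + n, j < k) (J *m (e (c j))^T) i 0) (\matrix_(i < n + n, j < k) (J *m (f (c j))^T) i 0).
have [u /eqP uC u0] : exists2 u : 'rV_(n + n), u *m C == 0 & u != 0.
  have : kermx C != 0.
    rewrite -mxrank_eq0 mxrank_ker subn_eq0 -ltnNge.
    by rewrite (leq_ltn_trans (rank_leq_col _)) // -addSn leq_add // ltnW.
  by case/rowV0Pn => u /sub_kermxP uC u0; exists u => //; apply/eqP.
have BE v w : B v w = \sum_i v 0 i * (J *m w^T) i 0 by rewrite /B -mulmxA mxE.
have ue j : B u (e (c j)) = 0.
  move/matrixP/(_ 0 (lshift k j)): uC; rewrite !mxE BE => uC; rewrite -[RHS]uC.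
  by apply: eq_bigr => i _; rewrite row_mxEl mxE.
have uf j : B u (f (c j)) = 0.
  move/matrixP/(_ 0 (rshift k j)): uC; rewrite !mxE BE => uC; rewrite -[RHS]uC.
  by apply: eq_bigr => i _; rewrite row_mxEr mxE.
have [w uw] : exists w, B u w = 1.
  have /rV0Pn[l ul] : u *m J != 0.
    by apply: contraNneq u0 => uJ; rewrite -(mulmxK Ju u) uJ mul0mx.
  exists (((u *m J) 0 l)^-1 *: delta_mx 0 l); rewrite BZr /B trmx_delta -colE [X in _ * X]mxE.
  by rewrite mulVf.
(* Gram-Schmidt correction: it makes [w] orthogonal to the earlier pairs and keeps [B u w = 1],
   since [u] is already orthogonal to them. *)
pose w' := w + \sum_j (B w (e (c j)) *: f (c j) - B w (f (c j)) *: e (c j)).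
have BNr v x : B v (- x) = - B v x by rewrite -scaleN1r BZr mulN1r.
have BNl v x : B (- v) x = - B v x by rewrite -scaleN1r BZl mulN1r.
have efc i j : [/\ B (e (c i)) (e (c j)) = 0, B (f (c i)) (f (c j)) = 0
    & B (e (c i)) (f (c j)) = (i == j)%:R].
  by have [-> -> ->] := ef (c i) (c j) (ltn_ord i) (ltn_ord j).
have uw' : B u w' = 1.
  rewrite BDr uw Bsumr big1 ?addr0 // => j _.
  by rewrite BDr BNr !BZr ue uf !mulr0 subr0.
have we' j : B w' (e (c j)) = 0.
  rewrite BDl Bsuml (bigD1 j) //= big1 => [|i ij].
    have [ee _ fe] := efc j j.
    by rewrite BDl BNl !BZl ee mulr0 subr0 (BC (f _)) fe eqxx mulrN mulr1 addr0 subrr.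
  have [ee _ _] := efc i j; have [_ _ fe] := efc j i.
  by rewrite BDl BNl !BZl ee mulr0 subr0 (BC (f _)) fe eq_sym (negPf ij) oppr0 mulr0.
have wf' j : B w' (f (c j)) = 0.
  rewrite BDl Bsuml (bigD1 j) //= big1 => [|i ij].
    have [_ ff fe] := efc j j.
    by rewrite BDl BNl !BZl ff fe eqxx mulr0 mulr1 sub0r addr0 subrr.
  have [_ ff fe] := efc i j.
  by rewrite BDl BNl !BZl ff fe (negPf ij) !mulr0 subr0.
have cP (i : 'I_n) : (i < k)%N -> exists j, i = c j.
  by move=> ik; exists (Ordinal ik); apply: val_inj.
exists (fun i : 'I_n => if i == k :> nat then u else e i), (fun i : 'I_n => if i == k :> nat then w' else f i).
move=> i j; rewrite !ltnS (leq_eqVlt i) (leq_eqVlt j) -(inj_eq val_inj) /=.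
case: eqP => [-> _ | _ /= ik]; case: eqP => [-> _ | _ /= jk]; rewrite ?eqxx.
- by rewrite !Bvv uw'.
- have [j' ->] := cP j jk; rewrite ue wf' uf gtn_eqF //=.
- have [i' ->] := cP i ik; rewrite (BC _ u) (BC _ w') ue wf' oppr0 (BC _ w') we' oppr0 ltn_eqF //=.
by have [-> -> ->] := ef i j ik jk.
Qed.

(** The form is taken alternating, not merely antisymmetric, so that characteristic 2 is covered. *)
Lemma symplectic_basis : exists Q, Q *m J *m Q^T = symp_form F n.
Proof.
have [e [f ef]] : partial_basis n.
  suff : forall k, (k <= n)%N -> partial_basis k by apply.
  elim=> [_|k IHk kn]; first by exists (fun=> 0), (fun=> 0).
  by apply: extend_basis => //; apply/IHk/ltnW.
have ME (g h : 'I_n -> 'rV[F]_(n + n)) (M : 'M[F]_n) : (forall i j, B (g i) (h j) = M i j) ->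
    (\matrix_i g i) *m J *m (\matrix_i h i)^T = M.
  move=> gh; apply/matrixP => i j; rewrite -gh /B.
  have -> : (g i *m J *m (h j)^T) = row i (\matrix_i g i) *m J *m (row j (\matrix_i h i))^T by rewrite !rowK.
  rewrite tr_row -row_mul [LHS]mxE [RHS]mxE; apply: eq_bigr => k _.
  by congr (_ * _); rewrite [RHS]mxE.
exists (col_mx (\matrix_i e i) (\matrix_i f i)).
rewrite mul_col_mx tr_col_mx mul_col_row /symp_form.
congr block_mx; apply: ME => i j; have [ee ff fe] := ef i j (ltn_ord i) (ltn_ord j); rewrite ?mxE //.
by have [_ _ fe'] := ef j i (ltn_ord j) (ltn_ord i); rewrite BC fe' eq_sym.
Qed.

End SymplecticBasis.

(** * Extraspecial normalizers *)

Section GeometricSum.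
Import GRing.Theory.
Local Open Scope ring_scope.

Lemma sum_root_unity (F : fieldType) (w : F) N : w ^+ N = 1 ->
  \sum_(k < N) w ^+ k = (N * (w == 1))%:R.
Proof.
move=> wN; have [->|w1] := eqVneq w 1.
  by under eq_bigr do rewrite expr1n; rewrite sumr_const card_ord muln1.
have /eqP := subrX1 w N; rewrite wN subrr eq_sym mulf_eq0 subr_eq0 (negPf w1) /=.
by rewrite muln0 => /eqP.
Qed.

(** The exponent [N - k] plays the role of [-k]. Summing [(d_i / d_j) ^ k] over a full period gives
    [N] when [d_i = d_j] and 0 otherwise, and distinctness leaves the [m] diagonal pairs. *)
Lemma sum_mxtrace_simple (F : fieldType) m N (A P : 'M[F]_m) (d : 'rV[F]_m) :
    P \in unitmx -> P *m A = diag_mx d *m P -> A ^+ N = 1%:M -> injective (d 0) ->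
  \sum_(k < N) \tr (A ^+ k) * \tr (A ^+ (N - k)) = (N * m)%:R.
Proof.
move=> Pu PA AN d_inj; have dN := diag_order Pu PA AN.
transitivity (\sum_(i < m) \sum_(j < m) \sum_(k < N) (d 0 i / d 0 j) ^+ k).
  under eq_bigr => k _ do rewrite !(mxtrace_diag Pu PA) big_distrlr /=.
  rewrite exchange_big; apply: eq_bigr => i _.
  rewrite exchange_big; apply: eq_bigr => j _; apply: eq_bigr => k _.
  have dj0 : d 0 j != 0.
    apply/eqP => dj; have := dN j; rewrite dj expr0n gtn_eqF ?(leq_trans _ (ltn_ord k)) //=.
    by move/eqP; rewrite eq_sym oner_eq0.
  rewrite exprMn exprVn; congr (_ * _); apply: (mulIf (expf_neq0 k dj0)).
  by rewrite -exprD subnK 1?ltnW // dN mulVf ?expf_neq0.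
have [N0|N_gt0] := posnP N.
  by rewrite N0 mul0n big1 // => i _; rewrite big1 // => j _; rewrite big_ord0.
under eq_bigr => i _.
  under eq_bigr => j _.
    rewrite sum_root_unity; last by rewrite exprMn exprVn !dN divr1.
    have dj0 : d 0 j != 0 by apply: contra_eq_neq (dN j) => ->; rewrite expr0n gtn_eqF // eq_sym oner_eq0.
    rewrite -(inj_eq (mulIf dj0)) mulfVK // mul1r (inj_eq d_inj).
    over.
  rewrite (bigD1 i) //= big1 => [|j /negPf ji]; last by rewrite eq_sym ji muln0.
  rewrite eqxx muln1 addr0.
  over.
by rewrite sumr_const card_ord -mulrnA.
Qed.

End GeometricSum.

Section ExtraspecialNormalizer.
Import Order.TTheory GRing.Theory Num.Theory.
Local Open Scope ring_scope.

Variables (C : numClosedFieldType) (p n : nat) (gT : finGroupType) (G R E : {group gT}).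
Variable rG : mx_representation C G (p ^ n)%N.
Hypotheses (p_pr : prime p) (rG_faithful : mx_faithful rG).
Hypotheses (nRG : R <| G) (defR : R :=: ('Z(R) * E)%g).
Hypotheses (pE : p.-group E) (esE : extraspecial E) (oE : #|E| = (p ^ (1 + 2 * n))%N).
Hypotheses (sEG : E \subset G) (irrE : mx_irreducible (subg_repr rG sEG)).
Hypothesis R_or : R :=: E \/ 'Z(R)%g \isog Zp 4.

Lemma sub_E_R : E \subset R.
Proof. by rewrite defR mulG_subr. Qed.

Let sRG : R \subset G := normal_sub nRG.

Lemma irr_cent_scalar (M : 'M[C]_(p ^ n)) : {in E, forall x, M *m rG x = rG x *m M} ->
  exists a, M = a%:M.
Proof.
move=> cM; have pn_gt0 : (0 < p ^ n)%N by rewrite expn_gt0 prime_gt0.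
have [a /eigenvalueP[v vM v0]] : exists a, eigenvalue M a.
  have [a a_root] : exists a, root (char_poly M) a.
    by apply/closed_rootP; rewrite size_char_poly eqSS -lt0n.
  by exists a; rewrite eigenvalue_root_char.
exists a; apply/eqP; rewrite -subr_eq0; apply/negPn/negP => M0.
have cM' : centgmx (subg_repr rG sEG) (M - a%:M).
  by apply/centgmxP => x Ex /=; rewrite mulmxBl mulmxBr cM // scalar_mxC.
have Mu := mx_Schur irrE cM' M0.
case/negP: v0; apply/eqP; apply: (can_inj (mulmxK Mu)).
by rewrite mul0mx mulmxBr vM mul_mx_scalar subrr.
Qed.

(** By Schur's lemma such an element acts as a scalar, and faithfulness then makes it central in
    [G]. *)
Lemma cent_E_center x : x \in G -> x \in 'C(E)%g -> x \in 'Z(G)%g.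
Proof.
move=> Gx cEx; have [a ra] : exists a, rG x = a%:M.
  apply: irr_cent_scalar => y Ey; have Gy := subsetP sEG y Ey.
  by rewrite -!repr_mxM // (centP cEx).
apply/centerP; split=> // y Gy; apply: (mx_faithful_inj rG_faithful); rewrite ?groupM //.
by rewrite !repr_mxM // ra scalar_mxC.
Qed.

Lemma center_scalar x : x \in 'Z(G)%g -> exists a, rG x = a%:M.
Proof.
case/centerP => Gx cGx; apply: irr_cent_scalar => y Ey; have Gy := subsetP sEG y Ey.
by rewrite -!repr_mxM // cGx.
Qed.

Lemma cent_R_center x : x \in G -> x \in 'C(R)%g -> x \in 'Z(G)%g.
Proof. by move=> Gx cRx; apply: cent_E_center => //; apply: subsetP cRx; rewrite centS ?sub_E_R. Qed.

Lemma ZR_ZG : 'Z(R)%g \subset 'Z(G)%g.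
Proof. by apply/subsetP => x /setIP[Rx cRx]; apply: cent_R_center => //; apply: subsetP Rx. Qed.

Lemma ZE_ZR : 'Z(E)%g = 'Z(R)%g :&: E.
Proof.
apply/eqP; rewrite eqEsubset subsetI center_sub andbT; apply/andP; split.
  apply/subsetP => x /setIP[Ex cEx]; have Rx := subsetP sub_E_R x Ex.
  by rewrite inE Rx; have /centerP[] := cent_E_center (subsetP sRG x Rx) cEx => _ cG;
     apply/centP => y Ry; apply: cG; apply: subsetP Ry.
apply/subsetP => x /setIP[/setIP[_ cRx] Ex]; rewrite inE Ex.
by apply: subsetP cRx; rewrite centS ?sub_E_R.
Qed.

Lemma ZE_sub_ZR : 'Z(E)%g \subset 'Z(R)%g.
Proof. by rewrite ZE_ZR subsetIl. Qed.

Lemma card_ZE : #|'Z(E)%g| = p.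
Proof. exact: card_center_extraspecial pE esE. Qed.

Lemma pgroup_R : p.-group R.
Proof.
case: R_or => [-> // | iso]; rewrite defR pgroupM pE andbT.
have cardZ : #|'Z(R)%g| = 4%N by rewrite (card_isog iso) card_Zp.
have : (p %| 4)%N by rewrite -cardZ -card_ZE; apply: cardSg ZE_sub_ZR.
rewrite -[4%N]/(2 ^ 2)%N Euclid_dvdX // andbT dvdn_prime2 // => /eqP ->.
by rewrite /pgroup cardZ.
Qed.

Lemma cyclic_ZR : cyclic 'Z(R)%g.
Proof.
case: R_or => [-> | iso]; first by rewrite prime_cyclic // card_ZE.
by rewrite (isog_cyclic iso); apply/cyclicP; exists Zp1; apply: (Zp_cycle 3).
Qed.

Lemma card_R : #|R| = (#|'Z(R)%g| * p ^ (n + n))%N.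
Proof.
have := mul_cardG 'Z(R)%G E; rewrite -defR -ZE_ZR card_ZE oE expnD expn1 mulnCA.
by move/eqP; rewrite [(#|R| * _)%N]mulnC eqn_pmul2l ?prime_gt0 // mul2n addnn => /eqP <-.
Qed.

(** The factors from ['Z(R)] drop out of the commutator. Landing in ['Z(E)], of order [p], and not
    just in ['Z(R)], makes the commutator form take values in the prime field. *)
Lemma comm_R_ZE x y : x \in R -> y \in R -> [~ x, y]%g \in 'Z(E)%g.
Proof.
have [[_ derE] _] := esE.
rewrite {1 2}defR => /mulsgP[z e Zz Ee ->] /mulsgP[z' e' Zz' Ee' ->].
have cz u : u \in 'Z(R)%g -> {in R, forall v, [~ u, v] = 1 /\ [~ v, u] = 1}%g.
  by case/setIP => _ /centP cu v Rv; split; apply/eqP/commgP; [|apply: commute_sym]; apply: cu.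
have Re := subsetP sub_E_R e Ee; have Re' := subsetP sub_E_R e' Ee'.
have Rz' := subsetP (center_sub R) z' Zz'.
have [c1 _] := cz z Zz (z' * e')%g (groupM Rz' Re').
have [_ c2] := cz z' Zz' e Re.
rewrite commMgJ c1 conj1g mul1g commgMJ c2 conj1g mulg1 -derE.
exact: mem_commg.
Qed.

(** Some conjugate of [x] is [x] times a nontrivial central element, which acts as a scalar
    [a != 1]; the trace is then equal to [a] times itself. *)
Lemma trace_noncentral x : x \in R -> x \notin 'Z(R)%g -> \tr (rG x) = 0.
Proof.
move=> Rx; rewrite inE Rx /= => /centP ncx.
have [y Ry xy] : exists2 y, y \in R & [~ x, y]%g != 1%g.
  apply/exists_inP; rewrite -negb_forall_in; apply/negP => /forall_inP cx.
  by apply: ncx => y Ry; apply/commgP; rewrite cx.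
have Gx := subsetP sRG x Rx; have Gy := subsetP sRG y Ry.
have Zc := subsetP ZE_sub_ZR _ (comm_R_ZE Rx Ry).
have Gc := subsetP sRG _ (subsetP (center_sub R) _ Zc).
have [a ra] := center_scalar (subsetP ZR_ZG _ Zc).
have a1 : a != 1.
  apply: contraNneq xy => a1; apply/eqP; apply: (mx_faithful_inj rG_faithful) => //.
  by rewrite ra a1 repr_mx1.
have trJ : \tr (rG (x ^ y)%g) = \tr (rG x).
  rewrite conjgE !repr_mxM ?groupM ?groupV // mxtrace_mulC -mulmxA -repr_mxM ?groupV //.
  by rewrite mulgV repr_mx1 mulmx1.
move: trJ; rewrite conjg_mulR repr_mxM // ra mul_mx_scalar linearZ /= => /eqP.
rewrite -{2}[\tr _]mul1r -subr_eq0 -mulrBl mulf_eq0 subr_eq0 (negPf a1) /=.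
by move/eqP.
Qed.

(** As the commutator is central in [G], its power of exponent [#[h]] is [[~ x, h ^+ #[h]] = 1]; it
    is also a p-element, while [#[h]] is prime to [p]. This lifts fixed points from [R / Z(R)] to
    [R]. *)
Lemma coprime_comm h x : h \in G -> p^'.-elt h -> x \in R -> [~ x, h]%g \in 'Z(R)%g ->
  [~ x, h]%g = 1%g.
Proof.
move=> Gh p'h Rx Zc; have /centerP[_ cG] := subsetP ZR_ZG _ Zc.
have /eqP : ([~ x, h] ^+ #[h] = 1)%g.
  by rewrite -commgX ?expg_order ?commg1 //; apply/esym/cG.
rewrite -order_dvdn => dv; apply/eqP; rewrite -order_eq1 -dvdn1.
have pc : p.-elt [~ x, h]%g by apply: mem_p_elt pgroup_R _; apply: subsetP Zc; apply: center_sub.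
have co : coprime #[[~ x, h]%g] #[h] by apply: pnat_coprime pc p'h.
by rewrite -(eqP co) dvdn_gcd dvdnn.
Qed.

(* By Schur, the sum of the [rG (h ^ x)] over [x] in [R] is scalar; multiply it by
   [rG h^-1] and take traces. *)
Lemma trace_formula h : h \in G -> p^'.-elt h ->
  #|'Z(R)%g|%:R * (\tr (rG h) * \tr (rG h^-1%g)) = #|'C_R[h]%g|%:R.
Proof.
move=> Gh p'h; have d0 : ((p ^ n)%:R : C) != 0 by rewrite pnatr_eq0 -lt0n expn_gt0 prime_gt0.
pose S := \sum_(x in R) rG (h ^ x)%g.
have GR x : x \in R -> x \in G := subsetP sRG x.
have [s defS] : exists s, S = s%:M.
  apply: irr_cent_scalar => y Ey; have Ry := subsetP sub_E_R y Ey.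
  rewrite mulmx_suml mulmx_sumr [RHS](reindex_inj (mulIg y)) /=.
  apply: eq_big => [x | x Rx]; first by rewrite groupMr.
  have [Gx Gy] := (GR x Rx, GR y Ry).
  by rewrite -!repr_mxM ?groupJ ?groupM // conjgM (conjgC (h ^ x)%g y).
have trS : #|R|%:R * \tr (rG h) = s *+ (p ^ n).
  rewrite -mxtrace_scalar -defS raddf_sum /= mulr_natl -sumr_const.
  apply: eq_bigr => x Rx; have Gx := GR x Rx.
  rewrite conjgE !repr_mxM ?groupM ?groupV // mxtrace_mulC -mulmxA -repr_mxM ?groupV //.
  by rewrite mulgV repr_mx1 mulmx1.
have trV : s * \tr (rG h^-1%g) = (p ^ n)%:R * #|'C_R[h]%g|%:R.
  transitivity (\tr (rG h^-1%g *m S)); first by rewrite defS mul_mx_scalar linearZ.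
  rewrite mulmx_sumr raddf_sum /=.
  rewrite (bigID [pred x | x \in 'C[h]]%g) /= addrC big1 ?add0r => [|x /andP[Rx nx]].
    rewrite mulrC mulr_natl -sumr_const; apply: eq_big => [x|x /andP[Rx cx]].
      by rewrite !inE.
    rewrite conjgE -(cent1P cx) mulKg -repr_mxM ?groupV // mulVg repr_mx1.
    by rewrite mxtrace_scalar.
  have Gx := GR x Rx.
  (* The product of the inverse of [h] with [h ^ x] is a commutator in [R]; were it central,
     [coprime_comm] would make [x] commute with [h], so its trace vanishes. *)
  rewrite -repr_mxM ?groupV ?groupJ // -[(_ * _)%g]/([~ h, x]%g); apply: trace_noncentral.
    by rewrite -(invgK [~ h, x]%g) groupV invg_comm commgEl groupM ?groupV // memJ_norm // (subsetP (normal_norm nRG)).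
  apply: contra nx => Zc; apply/cent1P/commgP/eqP; apply: coprime_comm => //.
  by rewrite -invg_comm groupV.
apply: (mulfI (expf_neq0 2 d0)).
transitivity (#|R|%:R * \tr (rG h) * \tr (rG h^-1%g)).
  by rewrite card_R natrM expnD natrM expr2; ring.
by rewrite trS mulrnAl trV -mulr_natl mulrA -expr2.
Qed.

Lemma repr_mx_expg g k : g \in G -> rG (g ^+ k)%g = rG g ^+ k.
Proof.
move=> Gg; elim: k => [|k IHk]; first by rewrite expr0 repr_mx1.
by rewrite expgS repr_mxM ?groupX // IHk exprSmx.
Qed.

Lemma sum_card_cent g : g \in G -> p^'.-elt g -> simple_spectrum rG g ->
  (\sum_(k < #[g]%g) #|'C_R[(g ^+ k)%g]%g| = #[g]%g * p ^ n * #|'Z(R)%g|)%N.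
Proof.
move=> Gg p'g ssg; set N := #[g]%g.
have AN : rG g ^+ N = 1%:M by rewrite -repr_mx_expg // expg_order repr_mx1.
have [|P Pu [d PA]] := finite_order_diag _ AN; first by rewrite pnatr_eq0 -lt0n order_gt0.
have := sum_mxtrace_simple Pu PA AN (simple_spectrum_inj Pu PA ssg).
move/(congr1 ( *%R #|'Z(R)%g|%:R)); rewrite mulr_sumr -natrM => sumN.
apply/eqP; rewrite -(eqr_nat C) mulnC -sumN natr_sum; apply/eqP/eq_bigr => k _.
have -> : rG g ^+ (N - k) = rG (g ^+ k)^-1%g.
  rewrite -repr_mx_expg //; suff -> : (g ^+ (N - k) = (g ^+ k)^-1)%g by [].
  apply: (mulIg (g ^+ k)%g).
  by rewrite mulVg -expgD subnK ?expg_order // ltnW.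
by rewrite -repr_mx_expg // trace_formula ?groupX ?p_eltX.
Qed.

(** * Coordinates on [R / Z(R)] and the commutator form *)

Section Coordinates.
Variable b : gT -> 'rV['F_p]_(n + n).
Hypothesis bM : {in R &, forall x y, b (x * y)%g = b x + b y}.
Hypothesis b_surj : forall v, exists2 x, x \in R & b x = v.
Hypothesis b_ker : {in R, forall x, b x = 0 <-> x \in 'Z(R)%g}.

Lemma additive_coord_eq k (phi : gT -> 'rV['F_p]_k) x y :
    {in R &, forall x y, phi (x * y)%g = phi x + phi y} ->
    {in 'Z(R)%g, forall x, phi x = 0} -> x \in R -> y \in R -> b x = b y -> phi x = phi y.
Proof.
move=> phiM phiZ Rx Ry bxy.
have phi1 : phi 1%g = 0 by apply: phiZ; apply: group1.
have Zxy : (y^-1 * x)%g \in 'Z(R)%g.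
  apply/b_ker; rewrite ?groupM ?groupV // bM ?groupV // bxy -bM ?groupV // mulVg.
  by apply/b_ker => //; apply: group1.
by rewrite -(mulKVg y x) phiM ?groupM ?groupV // (phiZ _ Zxy) addr0.
Qed.

Lemma coord_basis :
  exists r : 'I_(n + n) -> gT, forall i, r i \in R /\ b (r i) = delta_mx 0 i.
Proof.
apply: (@fin_all_exists _ (fun _ => gT) (fun i x => x \in R /\ b x = delta_mx 0 i)) => i.
by have [x Rx bx] := b_surj (delta_mx 0 i); exists x.
Qed.

(* Additive maps on [R] that vanish on the center are linear in the coordinates,
   since the prime field has no nontrivial scalars. *)
Lemma additive_linear k (phi : gT -> 'rV['F_p]_k) :
    {in R &, forall x y, phi (x * y)%g = phi x + phi y} ->
    {in 'Z(R)%g, forall x, phi x = 0} ->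
  exists M : 'M_(n + n, k), {in R, forall x, phi x = b x *m M}.
Proof.
move=> phiM phiZ.
have [r rP] := coord_basis.
exists (\matrix_i phi (r i)) => x Rx.
(* [y] is built to have the coordinates of [x], hence the same value of [phi], which additivity
   computes on a product of powers; [psi_prod] is applied to both [b] and [phi]. *)
pose y := (\prod_i r i ^+ (b x 0 i : nat))%g.
have Rr i : (r i ^+ (b x 0 i : nat))%g \in R by rewrite groupX; case: (rP i).
have psi_prod l (psi : gT -> 'rV['F_p]_l) : {in R &, forall x y, psi (x * y)%g = psi x + psi y} ->
    psi 1%g = 0 -> psi y = \sum_i b x 0 i *: psi (r i).
  move=> psiM psi1.
  have psiX z m : z \in R -> psi (z ^+ m)%g = m%:R *: psi z.
    move=> Rz; elim: m => [|m IHm]; first by rewrite scale0r.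
    by rewrite expgS psiM ?groupX // IHm -{1}[psi z]scale1r -scalerDl -mulrS.
  suff [_ ->] : y \in R /\ psi y = \sum_i psi (r i ^+ (b x 0 i : nat))%g.
    by apply: eq_bigr => i _; rewrite psiX ?natr_Zp //; case: (rP i).
  apply: (big_rec2 (fun u v => u \in R /\ psi u = v)) => [|i u v _ [Ru <-]]; first by rewrite group1.
  by rewrite groupM // psiM.
have b1 : b 1%g = 0 by apply/b_ker => //; apply: group1.
have Ry : y \in R by apply: group_prod.
have byx : b x = b y.
  rewrite (psi_prod _ b bM b1) {1}[b x]row_sum_delta; apply: eq_bigr => i _.
  by case: (rP i) => _ ->.
rewrite (additive_coord_eq phiM phiZ Rx Ry byx) (psi_prod _ phi phiM); last exact/phiZ/group1.
by rewrite mulmx_sum_row; apply: eq_bigr => i _; rewrite rowK.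
Qed.

Lemma card_coord_preim (S : {set 'rV['F_p]_(n + n)}) :
  #|[set x in R | b x \in S]| = (#|'Z(R)%g| * #|S|)%N.
Proof.
rewrite -sum1_card (partition_big b (mem S)) /=; last by move=> x; rewrite inE => /andP[].
transitivity (\sum_(v in S) #|'Z(R)%g|)%N; last by rewrite sum_nat_const mulnC.
apply: eq_bigr => v Sv; have [x Rx bx] := b_surj v.
rewrite -(card_lcoset _ x) -sum1_card; apply: eq_bigl => y.
rewrite !inE mem_lcoset -!andbA; apply/idP/idP => [/and3P[Ry _ /eqP by_] | Zxy].
  by apply/b_ker; rewrite ?groupM ?groupV // bM ?groupV // by_ -bx -bM ?groupV // mulVg; apply/b_ker.
have Ry : y \in R by rewrite -(mulKVg x y) groupM //; apply: subsetP Zxy; apply: center_sub.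
have -> : b y = v; last by rewrite Ry Sv eqxx.
rewrite -(mulKVg x y) bM ?groupM ?groupV // bx.
by have /b_ker -> := Zxy; rewrite ?addr0 // groupM ?groupV.
Qed.

End Coordinates.

Lemma Fp_expgD (z : gT) (k l : 'F_p) : #[z]%g = p ->
  (z ^+ nat_of_ord (k + l)%R = z ^+ nat_of_ord k * z ^+ nat_of_ord l :> gT)%g.
Proof.
move=> oz; have modE m : (m %% p = m %% (Zp_trunc (pdiv p)).+2)%N by rewrite Fp_cast.
by apply/eqP; rewrite -expgD eq_expg_mod_order oz !modE /= modn_mod.
Qed.

Lemma Fp_expg_inj (z : gT) (k l : 'F_p) : #[z]%g = p ->
  (z ^+ nat_of_ord k = z ^+ nat_of_ord l :> gT)%g -> k = l.
Proof.
move=> oz; have ltp (m : 'F_p) : (m < p)%N := leq_trans (ltn_ord m) (eq_leq (Fp_cast p_pr)).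
by move/eqP; rewrite eq_expg_mod_order oz !modn_small ?ltp // => /eqP/val_inj.
Qed.

Lemma cycle_FpP (z x : gT) : #[z]%g = p -> x \in <[z]>%g -> exists k : 'F_p, x = (z ^+ nat_of_ord k)%g.
Proof.
move=> oz /cyclePmin[m]; rewrite oz => m_lt ->.
have m_lt' : (m < (Zp_trunc (pdiv p)).+2)%N by rewrite Fp_cast.
by exists (Ordinal m_lt').
Qed.

Lemma ZE_gen : exists z, [/\ z \in 'Z(R)%g, #[z]%g = p & 'Z(E)%g = <[z]>%g].
Proof.
have /cyclicP[z defz] : cyclic 'Z(E)%g by rewrite prime_cyclic // card_ZE.
exists z; split=> //; last by rewrite /order -defz card_ZE.
by apply: (subsetP ZE_sub_ZR); rewrite defz cycle_id.
Qed.

Lemma expR_center x : x \in R -> (x ^+ p)%g \in 'Z(R)%g.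
Proof.
rewrite {1}defR => /mulsgP[z e Zz Ee ->].
have /centerP[_ cz] := Zz; rewrite expgMn; last by apply: cz; apply: (subsetP sub_E_R).
apply: groupM; first exact: groupX.
have [[defPhi _] _] := esE; apply: (subsetP ZE_sub_ZR); rewrite -defPhi (Phi_joing pE).
apply: (subsetP (joing_subr _ _)); rewrite -[p]expn1; apply: Mho_p_elt => //.
exact: mem_p_elt pE Ee.
Qed.

Lemma abelem_RZ : p.-abelem (R / 'Z(R))%g.
Proof.
rewrite abelemE // sub_der1_abelian /=; last first.
  by rewrite gen_subG; apply/subsetP => _ /imset2P[x y Rx Ry ->]; apply/(subsetP ZE_sub_ZR)/comm_R_ZE.
apply/exponentP => _ /morphimP[x Nx Rx ->]; rewrite -morphX //.
exact/coset_id/expR_center.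
Qed.

Lemma coord_exists : exists b : gT -> 'rV['F_p]_(n + n),
  [/\ {in R &, forall x y, b (x * y)%g = b x + b y},
      forall v, exists2 x, x \in R & b x = v
    & {in R, forall x, b x = 0 <-> x \in 'Z(R)%g}].
Proof.
have nZR : R \subset 'N('Z(R))%g by apply: normal_norm; apply: center_normal.
have : (R / 'Z(R))%g \isog [set: 'rV['F_p]_(n + n)].
  rewrite (isog_abelem_card _ abelem_RZ) mx_Fp_abelem //= cardsT card_mx mul1n card_Fp //.
  by rewrite card_quotient // -divgS ?center_sub // card_R mulKn.
case/isogP => f injf imf; exists (fun x => f (coset 'Z(R) x)).
have cosR x : x \in R -> coset 'Z(R) x \in (R / 'Z(R))%g by move=> Rx; apply: mem_quotient.
split=> [x y Rx Ry | v | x Rx].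
- by rewrite morphM ?morphM ?cosR // (subsetP nZR).
- have : v \in (f @* (R / 'Z(R)))%g by rewrite imf inE.
  by case/morphimP => _ _ /morphimP[x _ Rx ->] ->; exists x.
split=> [/eqP | Zx]; last by rewrite (coset_id Zx) morph1.
rewrite -[0]/(1%g : 'rV['F_p]_(n + n)) (morph_injm_eq1 injf) ?cosR // => /eqP/coset_idr.
by apply; apply: (subsetP nZR).
Qed.

Lemma comm_bilinear z : z \in 'Z(R)%g -> #[z]%g = p -> 'Z(E)%g = <[z]>%g ->
  exists beta : gT -> gT -> 'F_p,
    [/\ {in R &, forall x y, [~ x, y]%g = (z ^+ nat_of_ord (beta x y))%g},
        {in R & R & R, forall x y w, beta (x * y)%g w = beta x w + beta y w}
      & {in R & R & R, forall x y w, beta w (x * y)%g = beta w x + beta w y}].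
Proof.
move=> Zz oz defz.
(* The default 0 is never reached on [R], where commutators lie in [<[z]>]. *)
pose beta x y := odflt 0 [pick k : 'F_p | [~ x, y]%g == (z ^+ nat_of_ord k)%g].
have betaP : {in R &, forall x y, [~ x, y]%g = (z ^+ nat_of_ord (beta x y))%g}.
  move=> x y Rx Ry; rewrite /beta; case: pickP => [k /eqP // | no].
  have := comm_R_ZE Rx Ry; rewrite defz => /(cycle_FpP oz)[k xy].
  by have := no k; rewrite xy eqxx.
have commJ x y w : x \in R -> y \in R -> w \in R -> ([~ x, y] ^ w = [~ x, y])%g.
  move=> Rx Ry Rw; have /centerP[_ cZ] := subsetP ZE_sub_ZR _ (comm_R_ZE Rx Ry).
  by apply/conjg_fixP/commgP; apply: cZ.
exists beta; split=> // x y w Rx Ry Rw; apply: (Fp_expg_inj oz); rewrite Fp_expgD // -!betaP ?groupM //.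
  by rewrite commMgJ commJ.
have /centerP[_ cZ] := subsetP ZE_sub_ZR _ (comm_R_ZE Rw Rx).
by rewrite commgMJ commJ // cZ //; apply: (subsetP sub_E_R); apply: (subsetP (center_sub E)); apply: comm_R_ZE.
Qed.

(** In arbitrary coordinates the commutator form has some nondegenerate alternating matrix [J]; a
    symplectic basis [Q] for [J] provides the change of coordinates. *)
Lemma symp_coord_exists : exists b : gT -> 'rV['F_p]_(n + n), symp_coord R b.
Proof.
have [b [bM b_surj b_ker]] := coord_exists.
have [z [Zz oz defz]] := ZE_gen.
have [beta [betaP betaMl betaMr]] := comm_bilinear Zz oz defz.
have beta0l x y : x \in 'Z(R)%g -> y \in R -> beta x y = 0.
  move=> Zx Ry; have /centerP[Rx cx] := Zx; apply: (Fp_expg_inj oz).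
  by rewrite -betaP // expg0; apply/eqP/commgP; apply: cx.
have beta0r x y : x \in 'Z(R)%g -> y \in R -> beta y x = 0.
  move=> Zx Ry; have /centerP[Rx cx] := Zx; apply: (Fp_expg_inj oz).
  by rewrite -betaP // expg0; apply/eqP/commgP; apply/esym/cx.
have [r rP] := coord_basis b_surj.
have [Nc NcP] : exists Nc : 'I_(n + n) -> 'cV['F_p]_(n + n),
    forall i, {in R, forall y, (beta (r i) y)%:M = b y *m Nc i}.
  apply: (@fin_all_exists _ (fun _ => 'cV['F_p]_(n + n))
    (fun i M => {in R, forall y, (beta (r i) y)%:M = b y *m M})) => i.
  have [Rr _] := rP i.
  have [] := additive_linear bM b_surj b_ker (phi := fun y => (beta (r i) y)%:M : 'rV_1).
  - by move=> x y Rx Ry; rewrite betaMr // raddfD.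
  - by move=> x Zx; rewrite beta0r // raddf0.
  by move=> M MP; exists M.
pose J := \matrix_(i, j) Nc i j 0.
have betaJ : {in R &, forall x y, beta x y = (b x *m J *m (b y)^T) 0 0}.
  move=> x y Rx Ry.
  have [] := additive_linear bM b_surj b_ker (phi := fun x => (beta x y)%:M : 'rV_1).
  - by move=> u v Ru Rv; rewrite betaMl // raddfD.
  - by move=> u Zu; rewrite beta0l // raddf0.
  move=> M MP; have defM : M = J *m (b y)^T.
    apply/colP => i; have [Rr br] := rP i.
    have := MP _ Rr; rewrite br -rowE => /matrixP/(_ 0 0); rewrite !mxE => <-.
    have /matrixP/(_ 0 0) := NcP i y Ry; rewrite !mxE => ->.
    by apply: eq_bigr => j _; rewrite !mxE mulrC.
  by have /matrixP/(_ 0 0) := MP x Rx; rewrite defM mulmxA mxE.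
have altJ (v : 'rV_(n + n)) : v *m J *m v^T = 0.
  have [x Rx <-] := b_surj v; apply/matrixP => i j; rewrite !ord1 -betaJ // mxE.
  by apply: (Fp_expg_inj oz); rewrite -betaP // commgg.
(* A vector in the radical of the form comes from an element commuting with all of [R], so it is
   zero. *)
have Ju : J \in unitmx.
  rewrite -row_free_unit -kermx_eq0; apply/eqP/row_matrixP => i; rewrite row0.
  set v := row i _; have vJ : v *m J = 0 by rewrite -row_mul mulmx_ker row0.
  have [x Rx bx] := b_surj v; rewrite -bx; apply/b_ker => //.
  apply/centerP; split=> // y Ry; apply/commgP.
  by rewrite betaP // betaJ // bx vJ mul0mx mxE expg0.
have [Q QJ] := symplectic_basis altJ Ju.
have Qu : Q \in unitmx.
  have := symp_form_unit 'F_p n; rewrite -QJ !unitmx_mul.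
  by case/andP => /andP[].
exists (fun x => b x *m invmx Q); split.
- by move=> x y Rx Ry; rewrite bM // mulmxDl.
- move=> v; have [x Rx bx] := b_surj (v *m Q); exists x => //.
  by rewrite bx mulmxK.
- move=> x Rx; rewrite -b_ker //; split=> [e|->]; last exact: mul0mx.
  by rewrite -(mulmxKV Qu (b x)) e mul0mx.
exists z; split=> // x y Rx Ry; rewrite betaP // betaJ //; congr (z ^+ _)%g; congr (nat_of_ord _).
rewrite -QJ trmx_mul !mulmxA mulmxKV // -(mulmxA _ Q^T) -trmx_mul mulVmx // trmx1 mulmx1.
by [].
Qed.

(** * The action of [G] on [R / Z(R)] and its kernel *)

Section Embedding.
Variable b : gT -> 'rV['F_p]_(n + n).
Hypothesis bP : symp_coord R b.

Let H := ('Z(G) <*> R)%G.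

Let bM : {in R &, forall x y, b (x * y)%g = b x + b y}. Proof. by case: bP. Qed.
Let b_surj v : exists2 x, x \in R & b x = v. Proof. by case: bP. Qed.
Let b_ker : {in R, forall x, b x = 0 <-> x \in 'Z(R)%g}. Proof. by case: bP. Qed.

Let memJ_R x h : x \in R -> h \in G -> (x ^ h)%g \in R.
Proof. by move=> Rx Gh; rewrite memJ_norm // (subsetP (normal_norm nRG)). Qed.

Let ZG_fix x h : x \in 'Z(R)%g -> h \in G -> (x ^ h)%g = x.
Proof.
by move=> Zx Gh; have /centerP[_ cx] := subsetP ZR_ZG _ Zx; apply/conjg_fixP/commgP; apply: cx.
Qed.

Lemma coord_conj_fix x h : x \in R -> h \in G -> b (x ^ h)%g = b x <-> [~ x, h]%g \in 'Z(R)%g.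
Proof.
move=> Rx Gh; have Rxh := memJ_R Rx Gh; have Rc := groupM (groupVr Rx) Rxh; rewrite commgEl -(b_ker Rc).
rewrite (bM (groupVr Rx) Rxh); have bV : b (x^-1)%g = - b x.
  by apply/eqP; rewrite -addr_eq0 -bM ?groupV // mulVg; apply/eqP/b_ker.
rewrite bV addrC; split=> [->|/eqP]; [by rewrite subrr | by rewrite subr_eq0 => /eqP].
Qed.

Lemma conj_matrix_exists : exists M : gT -> 'M['F_p]_(n + n),
  {in G & R, forall h x, b (x ^ h)%g = b x *m M h}.
Proof.
have [r rP] := coord_basis b_surj.
exists (fun h => \matrix_i b (r i ^ h)%g) => h x Gh Rx.
have [] := additive_linear bM b_surj b_ker (phi := fun x => b (x ^ h)%g).
- by move=> u v Ru Rv; rewrite conjMg bM ?memJ_R.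
- by move=> u Zu; rewrite ZG_fix //; apply/b_ker => //; apply: (subsetP (center_sub R)).
move=> M MP; rewrite MP //; congr (_ *m _); apply/row_matrixP => i; rewrite rowK.
by have [Rr br] := rP i; rewrite MP // br rowE.
Qed.

Lemma coord_mx_inj (A B : 'M['F_p]_(n + n)) : {in R, forall x, b x *m A = b x *m B} -> A = B.
Proof.
move=> AB; apply/row_matrixP => i; have [x Rx bx] := b_surj (delta_mx 0 i).
by rewrite !rowE -bx AB.
Qed.

(** The substance is [kerMH]: if [h] acts trivially on [R / Z(R)], nondegeneracy yields [y] in [R]
    with the same commutators, and the quotient of [h] by [y] centralizes [R], so it is central in
    [G]. *)
Lemma symp_embedding_exists :
  exists rW : mx_representation 'F_p (G / ('Z(G) <*> R))%G (n + n), symp_embedding b rW.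
Proof.
have [M MP] := conj_matrix_exists.
have M_repr : mx_repr G M.
  split=> [|h k Gh Gk]; apply: coord_mx_inj => x Rx.
    by rewrite mulmx1 -MP ?group1 // conjg1.
  by rewrite mulmxA -!MP ?memJ_R ?groupM // conjgM.
pose rM := MxRepresentation M_repr.
have [_ _ _ [z [Zz oz zP]]] := bP.
have commZ x y h : x \in R -> y \in R -> h \in G -> ([~ x, y] ^ h = [~ x, y])%g.
  by move=> Rx Ry Gh; apply: ZG_fix => //; apply/(subsetP ZE_sub_ZR)/comm_R_ZE.
have HkerM : H \subset rker rM.
  rewrite join_subG; apply/andP; split; apply/subsetP => u Hu; apply/rkerP.
    have /centerP[Gu cu] := Hu; split=> //; apply: coord_mx_inj => x Rx.
    rewrite mulmx1 -MP //; congr b; apply/conjg_fixP/commgP.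
    by apply/esym/cu; apply: (subsetP sRG).
  have Gu := subsetP sRG u Hu; split=> //; apply: coord_mx_inj => x Rx.
  rewrite mulmx1 -MP //; apply/coord_conj_fix => //.
  exact/(subsetP ZE_sub_ZR)/comm_R_ZE.
have kerMH : rker rM \subset H.
  apply/subsetP => h /rkerP[Gh /= Mh].
  have comm_h x : x \in R -> [~ x, h]%g \in 'Z(R)%g.
    by move=> Rx; apply/coord_conj_fix; rewrite // MP // Mh mulmx1.
  (* [[~ x, h] ^+ p = [~ x ^+ p, h] = 1], and the cyclic group ['Z(R)] has only one subgroup of
     order [p]; this matters when ['Z(R)] has order 4. *)
  have comm_z x : x \in R -> [~ x, h]%g \in <[z]>%g.
    move=> Rx; have Zc := comm_h x Rx; have /centerP[_ cc] := Zc.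
    have cp : ([~ x, h] ^+ p = 1)%g.
      rewrite -commXg; last by apply/esym/cc.
      by apply/eqP/commgP; have /centerP[_ cG] := subsetP ZR_ZG _ (expR_center Rx); apply: cG.
    have [-> | nt] := eqVneq [~ x, h]%g 1%g; first exact: group1.
    have oc : #[[~ x, h]%g] = p by apply: nt_prime_order.
    have /eqP <- : <[[~ x, h]]>%g == <[z]>%g :> {set gT}; last exact: cycle_id.
    have := eq_subG_cyclic cyclic_ZR (H := <[[~ x, h]]>%G) (K := <[z]>%G).
    by rewrite !cycle_subG -!orderE oc oz eqxx => ->.
  have [r rP] := coord_basis b_surj.
  have [c cP] : exists c : 'I_(n + n) -> 'F_p, forall i, [~ r i, h]%g = (z ^+ nat_of_ord (c i))%g.
    apply: (@fin_all_exists _ (fun _ => 'F_p) (fun i k => [~ r i, h]%g = (z ^+ nat_of_ord k)%g)) => i.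
    by apply: cycle_FpP => //; apply: comm_z; case: (rP i).
  have Ju := symp_form_unit 'F_p n.
  (* Solves [b (r i) *m symp_form *m (b y)^T = c i] for all basis elements at once. *)
  have [y Ry by_] := b_surj (invmx (symp_form 'F_p n) *m (\col_i c i))^T.
  have Gy := subsetP sRG y Ry.
  have comm_r i : [~ r i, h]%g = [~ r i, y]%g.
    have [Rr br] := rP i; rewrite cP zP // br by_ trmxK -mulmxA mulKVmx //.
    by rewrite -rowE !mxE.
  (* Agreement is known on the [r i] only; it spreads to [R] because [x] maps additively to its
     commutator with [h * y^-1] and ['Z(R)] is killed. *)
  have cent_hy : (h * y^-1)%g \in 'C(R)%g.
    have Gk : (h * y^-1)%g \in G by rewrite groupM ?groupV.
    have fix_r i : (r i ^ (h * y^-1) = r i)%g.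
      by rewrite conjgM (conjg_mulR (r i) h) comm_r -conjg_mulR conjgK.
    have kill x : x \in R -> [~ x, (h * y^-1)%g]%g \in <[z]>%g.
      move=> Rx; rewrite commgMJ; apply: groupM.
        by rewrite zP ?groupV //; apply: mem_cycle.
      by have := comm_z x Rx => cz; rewrite ZG_fix ?groupV ?comm_h.
    pose beta x := odflt 0 [pick k : 'F_p | [~ x, (h * y^-1)]%g == (z ^+ nat_of_ord k)%g].
    have betaP : {in R, forall x, [~ x, (h * y^-1)]%g = (z ^+ nat_of_ord (beta x))%g}.
      move=> x Rx; rewrite /beta; case: pickP => [k /eqP // | no].
      by have [k xk] := cycle_FpP oz (kill x Rx); have := no k; rewrite xk eqxx.
    have [] := additive_linear bM b_surj b_ker (phi := fun x => (beta x)%:M : 'rV_1).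
    - move=> u v Ru Rv; rewrite -raddfD; congr (_ %:M); apply: (Fp_expg_inj oz).
      rewrite Fp_expgD // -!betaP ?groupM // commMgJ ZG_fix ?(subsetP sRG) //.
      by rewrite betaP // groupX.
    - move=> u Zu; have Ru := subsetP (center_sub R) u Zu.
      suff -> : beta u = 0 by rewrite raddf0.
      apply: (Fp_expg_inj oz); rewrite -betaP // expg0; apply/eqP/commgP.
      by have /centerP[_ cG] := subsetP ZR_ZG _ Zu; apply: cG.
    move=> B BP; have B0 : B = 0.
      apply/row_matrixP => i; have [Rr br] := rP i; rewrite row0 rowE -br -BP //.
      suff -> : beta (r i) = 0 by rewrite raddf0.
      apply: (Fp_expg_inj oz); rewrite -betaP // expg0.
      by apply/eqP; rewrite -conjg_fix fix_r.
    apply/centP => x Rx; apply: commute_sym; apply/commgP; rewrite betaP //.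
    have /matrixP/(_ 0 0) := BP x Rx; rewrite B0 mulmx0 !mxE eqxx mulr1n => ->.
    by rewrite expg0.
  rewrite -(mulgKV y h); apply: groupM; last by apply: (subsetP (joing_subr _ _)).
  by apply: (subsetP (joing_subl _ _)); apply: cent_R_center cent_hy; rewrite groupM ?groupV.
have nHG : G \subset 'N(H).
  by have /eqP -> : H :==: rker rM; [rewrite eqEsubset HkerM | apply: rker_norm].
exists (quo_repr HkerM nHG); split.
- move=> h x Gh Rx; rewrite MP //; congr (_ *m _).
  exact/esym/(quo_repr_coset HkerM nHG Gh).
- rewrite /mx_faithful rker_quo; apply/subsetP => _ /morphimP[h Nh kh ->].
  by apply/set1gP; apply: coset_id; apply: (subsetP kerMH).
move=> _ /morphimP[h Nh Gh ->].
suff : symplectic (M h) by rewrite -[M h](quo_repr_coset HkerM nHG Gh).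
apply/matrixP => i j.
have [x Rx bx] := b_surj (delta_mx 0 i); have [y Ry by_] := b_surj (delta_mx 0 j).
have entry (S : 'M['F_p]_(n + n)) : S i j = (b x *m S *m (b y)^T) 0 0.
  by rewrite bx by_ -rowE trmx_delta -colE !mxE.
(* Commutators of [R] are central in [G], so conjugation by [h] leaves the form unchanged. *)
rewrite !entry; have := commZ x y h Rx Ry Gh; rewrite conjRg !zP ?memJ_R // => /(Fp_expg_inj oz) <-.
by rewrite !MP // trmx_mul !mulmxA.
Qed.

End Embedding.

(** * The action of the given p'-element *)

Section Element.
Variables (b : gT -> 'rV['F_p]_(n + n)).
Variable rW : mx_representation 'F_p (G / ('Z(G) <*> R))%G (n + n).
Hypotheses (bP : symp_coord R b) (rWP : symp_embedding b rW).
Variable g : gT.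
Hypotheses (Gg : g \in G) (p'g : p^'.-elt g) (ssg : simple_spectrum rG g).

Let c := coset ('Z(G) <*> R)%g g.
Let A := rW c.
Let N := #[g]%g.

Let Gc : c \in (G / ('Z(G) <*> R))%g.
Proof. exact: mem_quotient. Qed.

Lemma coset_mx_symplectic : symplectic A.
Proof. by case: rWP => _ _; apply. Qed.

Lemma coset_mx_expg k : rW (c ^+ k)%g = A ^+ k.
Proof.
elim: k => [|k IHk]; first by rewrite expg0 expr0 repr_mx1.
by rewrite expgS repr_mxM ?groupX // IHk exprSmx.
Qed.

Lemma coord_conj_expg k x : x \in R -> b (x ^ (g ^+ k))%g = b x *m A ^+ k.
Proof.
have [rWJ _ _] := rWP; elim: k x => [|k IHk] x Rx; first by rewrite expg0 conjg1 mulmx1.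
have Rxg : (x ^ g)%g \in R by rewrite memJ_norm // (subsetP (normal_norm nRG)).
by rewrite expgS conjgM IHk // rWJ // -mulmxA exprSmx.
Qed.

Lemma cent_expg k x : x \in R -> (x \in 'C[(g ^+ k)%g]%g) = (b x *m A ^+ k == b x).
Proof.
move=> Rx; rewrite -coord_conj_expg //; have Gk : (g ^+ k)%g \in G by rewrite groupX.
apply/cent1P/eqP => [/commgP/eqP xg | bxg].
  by apply/(coord_conj_fix bP Rx Gk); rewrite xg group1.
apply/commgP/eqP; apply: coprime_comm; rewrite ?p_eltX //.
exact/(coord_conj_fix bP Rx Gk).
Qed.

(** A power of [g] acting trivially on [R / Z(R)] centralizes [R], since [g] is a p'-element. Hence
    [g] has the same order modulo [Z(G)] as modulo [Z(G)R], namely that of [A]. *)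
Lemma expg_center k : (g ^+ k)%g \in 'Z(G)%g <-> A ^+ k = 1%:M.
Proof.
split=> [Zg | Ak].
  apply: (coord_mx_inj bP) => x Rx; apply/eqP; rewrite mulmx1 -cent_expg //.
  by have /centerP[_ cg] := Zg; apply/cent1P/esym/cg; apply: (subsetP sRG).
apply: cent_R_center; first exact: groupX.
apply/centP => x Rx; apply/esym/cent1P.
by rewrite cent_expg // Ak mulmx1.
Qed.

Lemma coset_center_expg k : (#[coset 'Z(G)%g g]%g %| k)%N <-> A ^+ k = 1%:M.
Proof.
have Ng : g \in 'N('Z(G))%g by apply: subsetP Gg; apply: normal_norm; apply: center_normal.
rewrite -expg_center order_dvdn -morphX //; split=> [/eqP/coset_idr | Zg].
  by apply; rewrite groupX.
exact/eqP/coset_id.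
Qed.

Lemma coset_expg k : (#[c]%g %| k)%N <-> A ^+ k = 1%:M.
Proof.
have [_ faithW _] := rWP; rewrite order_dvdn; split=> [/eqP ck|Ak].
  by rewrite -coset_mx_expg ck repr_mx1.
apply/eqP/set1gP; apply: (subsetP faithW); apply/rkerP; split; first exact: groupX.
by rewrite coset_mx_expg.
Qed.

Lemma coset_mx_order : A ^+ N = 1%:M.
Proof. by apply/expg_center; rewrite expg_order group1. Qed.

Lemma coprime_pN : coprime p N.
Proof. by rewrite prime_coprime // -p'natE. Qed.

Lemma card_fixed k : #|'C_R[(g ^+ k)%g]%g| = (#|'Z(R)%g| * p ^ \rank (kermx (A ^+ k - 1%:M)))%N.
Proof.
have [bM b_surj b_ker _] := bP.
have -> : 'C_R[(g ^+ k)%g]%g = [set x in R | b x \in rowg (kermx (A ^+ k - 1%:M))].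
  apply/setP => x; rewrite in_setI [RHS]inE; case Rx: (x \in R) => //=; rewrite cent_expg //.
  rewrite mem_rowg sub_kermx mulmxBr mulmx1 subr_eq0.
  by [].
by rewrite (card_coord_preim bM b_surj b_ker) card_rowg card_Fp.
Qed.

Lemma element_spectrum : exists (P : 'M[Fpbar p]_(n + n)) (d : 'rV[Fpbar p]_(n + n))
    (t : nat) (a : 'I_t -> nat),
  [/\ P \in unitmx /\ P *m map_mx (@Fp_inj p) A = diag_mx d *m P,
      [/\ forall i j : 'I_t, (i < j)%N -> (a j < a i)%N, forall i, (1 <= a i)%N
        & n = (\sum_(i < t) a i)%N],
      (forall i j : 'I_t, i != j -> coprime (p ^ a i + 1) (p ^ a j + 1)) /\
      (\big[lcmn/1]_(i < t) (p ^ a i + 1) = \prod_(i < t) (p ^ a i + 1))%N,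
      [/\ injective (d 0), forall i, exists j, (p ^ a j + 1).-primitive_root (d 0 i)
        & forall j, exists i, (p ^ a j + 1).-primitive_root (d 0 i)]
    & forall i j M, M.-primitive_root (d 0 i) -> M.-primitive_root (d 0 j) ->
        exists k, d 0 j = d 0 i ^+ (p ^ k)].
Proof.
set iota := Fp_inj p; have N_gt0 : (0 < N)%N := order_gt0 g.
have AN : map_mx iota A ^+ N = 1%:M by rewrite -map_mxX coset_mx_order map_mx1.
have N0 : N%:R != 0 :> Fpbar p.
  by rewrite -(dvdn_pcharf (pchar_ext p_pr iota)) -prime_coprime // coprime_pN.
have [P Pu [d PA]] := finite_order_diag N0 AN.
have sA : symplectic (map_mx iota A) by apply/map_symplectic; apply: coset_mx_symplectic.
have count : (\sum_(k < N) p ^ #|[set i | (d 0 i ^+ k == 1)%R]| = N * p ^ n)%N.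
  apply/eqP; rewrite -(@eqn_pmul2l #|'Z(R)%g|) ?cardG_gt0 // [X in _ == X]mulnC.
  rewrite -sum_card_cent // big_distrr /=; apply/eqP; apply: eq_bigr => k _.
  rewrite card_fixed -(mxrank_fixed Pu PA) -(mxrank_map iota) map_kermx map_mxB map_mxX map_mx1.
  by [].
have [t [a [[a_decr a_gt0] n_sum [cop_a lcm_a] d_spec d_orb]]] :=
  extremal_spectrum p_pr N_gt0 coprime_pN (diag_order Pu PA AN)
    (eigenvalue_frob p_pr Pu PA) (eigenvalue_inv Pu PA sA) erefl count.
by exists P, d, t, a.
Qed.

Lemma element_torus : finite_Sp_max_torus [set rW y | y in <[c]>%g].
Proof.
have [P [d [t [a [[Pu PA] [_ a_gt0 _] [cop_a _] [d_inj d_prim a_prim] d_orb]]]]] :=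
  element_spectrum.
have sA := coset_mx_symplectic.
apply: (cent_symp_finite_torus p_pr Pu PA sA d_inj) => [i | X].
  (* A self-inverse eigenvalue has order dividing 2, whereas each order [p ^ a + 1] is at least
     3. *)
  have [j prim] := d_prim i; apply/eqP => d2.
  have : (p ^ a j + 1 %| 2)%N by rewrite (prim_order_dvd prim) expr2 d2.
  move/dvdn_leq; rewrite addn1 => /(_ isT); rewrite ltnS leqNgt.
  by rewrite -(exp1n (a j)) ltn_exp2r ?prime_gt1 ?a_gt0.
split=> [/imsetP[y /cycleP[k ->] ->] | [sX cX]].
  rewrite coset_mx_expg; split.
    by rewrite -coset_mx_expg; case: rWP => _ _; apply; apply: groupX.
  by rewrite -exprSmx; apply/esym/exprSr.
have [k ->] := cent_symp_power p_pr Pu PA sA d_inj sX cX cop_a d_prim a_prim d_orb.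
by apply/imsetP; exists (c ^+ k)%g; rewrite ?mem_cycle ?coset_mx_expg.
Qed.

(** The order of a diagonalizable matrix is the lcm of the orders of its eigenvalues, here the
    product of the [p ^ a i + 1]. None of these is 1, so 1 is not an eigenvalue and [A - 1] is
    invertible, as the exponent computation needs. *)
Lemma element_order : exists (t : nat) (a : 'I_t -> nat),
  [/\ [/\ forall i j : 'I_t, (i < j)%N -> (a j < a i)%N, forall i, (1 <= a i)%N
        & n = (\sum_(i < t) a i)%N],
      forall i j : 'I_t, i != j -> coprime (p ^ a i + 1) (p ^ a j + 1),
      #[coset 'Z(G)%g g]%g = (\prod_(i < t) (p ^ a i + 1))%N,
      #[c]%g = (\prod_(i < t) (p ^ a i + 1))%N
    & A - 1%:M \in unitmx].
Proof.
have [P [d [t [a [[Pu PA] [a_decr a_gt0 n_sum] [cop_a lcm_a] [d_inj d_prim a_prim] _]]]]] :=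
  element_spectrum.
have AkP k : A ^+ k = 1%:M <-> (\prod_(i < t) (p ^ a i + 1) %| k)%N.
  rewrite -lcm_a; split=> [Ak | /dvdn_biglcmP dv].
    apply/dvdn_biglcmP => j _; have [i prim] := a_prim j; rewrite (prim_order_dvd prim).
    apply/eqP; apply: (diag_order Pu PA).
    by rewrite -map_mxX Ak map_mx1.
  apply: (@map_mx_inj _ _ (Fp_inj p)); rewrite map_mxX map_mx1; apply: (order_diag Pu PA) => i.
  by have [j prim] := d_prim i; apply/eqP; rewrite -(prim_order_dvd prim) dv.
have orderE m : (forall k, (m %| k)%N <-> A ^+ k = 1%:M) -> m = (\prod_(i < t) (p ^ a i + 1))%N.
  move=> mP; apply/eqP; rewrite eqn_dvd; apply/andP; split.
    by apply/mP/AkP.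
  by apply/AkP/mP.
exists t, a; split=> //.
- exact/orderE/coset_center_expg.
- exact/orderE/coset_expg.
rewrite -row_free_unit -kermx_eq0 -mxrank_eq0 -(mxrank_map (Fp_inj p)) map_kermx map_mxB map_mx1.
rewrite -[X in map_mx _ X]expr1 map_mxX (mxrank_fixed Pu PA) cards_eq0; apply/eqP/setP => i.
rewrite !inE; have [j prim] := d_prim i.
rewrite -(prim_order_dvd prim) dvdn1 addn1 eqSS expn_eq0.
by rewrite eqn0Ngt prime_gt0.
Qed.

(* As 1 is not an eigenvalue of [A], every element of [R] is a commutator [[~ y, g]]
   up to the center, and [y] and [y ^ g] have the same, central, [p]-th power. *)
Lemma exponent_odd : (2 < p)%N -> exponent R = p.
Proof.
move=> p_gt2; have [t [a [_ _ _ _ A1u]]] := element_order.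
(* If ['Z(R)] had order 4, its subgroup ['Z(E)] of order [p] would force [p = 2]. *)
have RE : R :=: E.
  case: R_or => // iso; have : (p %| #|Zp 4|)%N.
    by rewrite -(card_isog iso) -card_ZE; apply: cardSg ZE_sub_ZR.
  rewrite card_Zp // -[4%N]/(2 ^ 2)%N Euclid_dvdX // andbT dvdn_prime2 // => /eqP p2.
  by rewrite p2 in p_gt2.
have ZRp x : x \in 'Z(R)%g -> (x ^+ p = 1)%g.
  move=> Zx; apply/eqP; rewrite -order_dvdn -card_ZE -[X in (_ %| #|'Z(X)|)%N]RE.
  exact: order_dvdG.
have expRp x : x \in R -> (x ^+ p = 1)%g.
  move=> Rx; have [bM b_surj b_ker _] := bP; have [rWJ _ _] := rWP.
  have [y Ry by_] := b_surj (b x *m invmx (A - 1%:M)).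
  have Ryg : (y ^ g)%g \in R by rewrite memJ_norm // (subsetP (normal_norm nRG)).
  have RyV := groupVr Ry; have Ryc := groupM RyV Ryg.
  have b_comm : b (y^-1 * y ^ g)%g = b x.
    rewrite (bM _ _ RyV Ryg) rWJ //; have -> : b y^-1%g = - b y.
      by apply/eqP; rewrite -addr_eq0 -(bM _ _ RyV Ry) mulVg; apply/eqP/b_ker.
    by rewrite addrC -[X in _ - X]mulmx1 -mulmxBr by_ mulmxKV.
  pose w := (y^-1 * y ^ g)%g; have Zw : (w^-1 * x)%g \in 'Z(R)%g.
    apply/b_ker; rewrite ?groupM ?groupV // (bM _ _ (groupVr Ryc) Rx) -b_comm.
    by rewrite -(bM _ _ (groupVr Ryc) Ryc) mulVg; apply/b_ker.
  have wp : (w ^+ p = 1)%g.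
    have Zc := subsetP ZE_sub_ZR _ (comm_R_ZE Ryg RyV); have /centerP[_ cc] := Zc.
    (* Class-two power formula: the correction is a central commutator raised to the binomial
       coefficient of [p] over 2, which [p] divides because [p > 2]. *)
    rewrite expMg_Rmul; [|by apply/esym/cc|by apply/esym/cc].
    have /dvdnP[q ->] : (p %| 'C(p, 2))%N by rewrite prime_dvd_bin.
    rewrite mulnC expgM (ZRp _ Zc) expg1n mulg1 expgVn -conjXg.
    have /centerP[_ cG] := subsetP ZR_ZG _ (expR_center Ry).
    have /commgP/conjg_fixP -> : commute (y ^+ p)%g g by apply: cG.
    exact: mulVg.
  rewrite -(mulKVg w x) expgMn; last first.
    by have /centerP[_ cc] := Zw; apply/esym/cc.
  by rewrite wp mul1g ZRp.
have dvd_p : (exponent R %| p)%N by apply/exponentP.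
have [_ /(_ _ dvd_p)/orP[/eqP e1|/eqP //]] := primeP p_pr.
have : R :==: 1%g by rewrite trivg_exponent e1.
rewrite RE trivg_card1 oE expnD expn1 muln_eq1 => /andP[/eqP p1 _].
by have := prime_gt1 p_pr; rewrite p1.
Qed.

End Element.

Lemma generates_max_torus_simple g : g \in G -> p^'.-elt g -> simple_spectrum rG g ->
  generates_max_torus p n G R g.
Proof.
move=> Gg p'g ssg; split=> [|b bP]; first exact: symp_coord_exists.
have [rW rWP] := symp_embedding_exists bP; exists rW => //.
exact (element_torus bP rWP Gg p'g ssg).
Qed.

Lemma simple_spectrum_order g : g \in G -> p^'.-elt g -> simple_spectrum rG g ->
  exists (t : nat) (a : 'I_t -> nat),
  [/\ [/\ forall i j : 'I_t, (i < j)%N -> (a j < a i)%N, forall i, (1 <= a i)%N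
        & n = (\sum_(i < t) a i)%N],
      forall i j : 'I_t, i != j -> coprime (p ^ a i + 1) (p ^ a j + 1),
      #[coset 'Z(G)%g g]%g = (\prod_(i < t) (p ^ a i + 1))%N,
      #[coset ('Z(G) <*> R)%g g]%g = (\prod_(i < t) (p ^ a i + 1))%N
    & (2 < p)%N -> exponent R = p].
Proof.
move=> Gg p'g ssg; have [b bP] := symp_coord_exists.
have [rW rWP] := symp_embedding_exists bP.
have [t [a [aP cop oZ oH _]]] := element_order bP rWP Gg p'g ssg.
by exists t, a; split=> //; apply: (exponent_odd bP rWP Gg p'g ssg).
Qed.

End ExtraspecialNormalizer.

(** * Splitting the cyclic group and separating odd [p] from [p = 2] *)

Lemma cycle_bigdprod (gT : finGroupType) (x : gT) t (M : 'I_t -> nat) :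
    #[x] = (\prod_(i < t) M i)%N -> (forall i j, i != j -> coprime (M i) (M j)) ->
  exists2 H : 'I_t -> {group gT}, \big[dprod/1]_(i < t) H i = <[x]>
    & forall i, cyclic (H i) /\ #|H i| = M i.
Proof.
move=> ox cop; pose H i := <[x ^+ (#[x] %/ M i)]>%G.
have dv i : M i %| #[x] by rewrite ox (bigD1 i) //= dvdn_mulr.
have cardH i : #|H i| = M i.
  rewrite /= -orderE orderXdiv ?divn_dvd ?dvdn_div ?dv //.
  by rewrite divnA ?dv // mulKn.
have sH i : H i \subset <[x]> by rewrite cycle_subG mem_cycle.
have abH i j : H i \subset 'C(H j).
  by apply: subset_trans (sH i) _; apply: subset_trans (cycle_abelian x) _; apply: centS.
have /eqP cprodH : \big[cprod/1]_(i < t) H i == (\prod_(i < t) H i)%G by apply/bigcprodYP.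
have dprodH := bigcprod_coprime_dprod cprodH (fun i j _ _ ij =>
  etrans (f_equal2 coprime (cardH i) (cardH j)) (cop i j ij)).
exists H => [|i]; last by rewrite cardH cycle_cyclic.
rewrite dprodH; apply/eqP; rewrite eqEcard bigprodGE gen_subG; apply/andP; split.
  by apply/bigcupsP.
rewrite -bigprodGE -(bigdprod_card dprodH) -orderE ox; apply: eq_leq.
by apply: eq_bigr => i _; rewrite cardH.
Qed.

Theorem theorem8p5 (K : realType) (p n : nat) (p_pr : prime p)
    (gT : finGroupType) (G R E : {group gT})
    (rG : mx_representation K[i] G (p ^ n)%N)
    (rG_faithful : mx_faithful rG) (rG_Splus : Splus rG)
    (nRG : R <| G) (defR : R :=: 'Z(R) * E)
    (pE : p.-group E) (esE : extraspecial E)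
    (oE : #|E| = (p ^ (1 + 2 * n))%N)
    (sEG : E \subset G) (irrE : mx_irreducible (subg_repr rG sEG))
    (R_or : R :=: E \/ 'Z(R) \isog Zp 4)
    (g : gT) (Gg : g \in G) (p'g : p^'.-elt g)
    (ssg : simple_spectrum rG g) (pn_ge11 : (11 <= p ^ n)%N) :
  ((2 < p)%N ->
     [/\ exponent R = p,
         #[coset 'Z(G) g] = (p ^ n + 1)%N,
         #[coset ('Z(G) <*> R) g] = (p ^ n + 1)%N
       & generates_max_torus p n G R g])
  /\
  (p = 2%N ->
     exists (t : nat) (a : 'I_t -> nat),
       [/\ (forall i j : 'I_t, (i < j)%N -> (a j < a i)%N) /\
           (forall i, (1 <= a i)%N),
           n = (\sum_(i < t) a i)%N,
           forall i j : 'I_t, i != j -> gcdn (2 ^ a i + 1) (2 ^ a j + 1) = 1%N,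
           #[coset 'Z(G) g] = (\prod_(i < t) (2 ^ a i + 1))%N
         & (exists2 H : 'I_t -> {group coset_of ('Z(G) <*> R)},
              \big[dprod/1]_(i < t) H i = <[coset ('Z(G) <*> R) g]>
            & forall i, cyclic (H i) /\ #|H i| = (2 ^ a i + 1)%N)
           /\ generates_max_torus p n G R g]).
Proof.
have torus := generates_max_torus_simple p_pr rG_faithful nRG defR pE esE oE irrE R_or Gg p'g ssg.
have [t [a [[a_decr a_gt0 n_sum] cop oZ oH expR]]] :=
  simple_spectrum_order p_pr rG_faithful nRG defR pE esE oE irrE R_or Gg p'g ssg.
split=> [p_gt2 | p2].
  have p_odd : odd p by case: (even_prime p_pr) p_gt2 => [->|].
  have prodE : (\prod_(i < t) (p ^ a i + 1) = p ^ n + 1)%N.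
    (* No order would give [n = 0], against [11 <= p ^ n]; two orders would both be even, since [p]
       is odd, against coprimality. So there is one order, with [a = n]. *)
    case: t a {a_decr a_gt0 oZ oH} n_sum cop => [|[|t]] a n_sum cop.
    - by move: pn_ge11; rewrite n_sum big_ord0.
    - by rewrite n_sum !big_ord1.
    have ev i : 2 %| p ^ a i + 1 by rewrite dvdn2 addn1 /= oddX p_odd orbT.
    by have := cop ord0 ord_max isT => /(coprime_dvdl (ev _))/(coprime_dvdr (ev _)).
  by rewrite oZ oH prodE expR.
exists t, a; split=> //.
- by move=> i j /cop/eqP; rewrite p2.
- by rewrite oZ p2.
split=> //; apply: cycle_bigdprod => [|i j]; first by rewrite oH p2.
by move/cop; rewrite p2.
Qed.
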